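(* Let $\alpha \geq 1$ be a real number, and suppose there is a constant $C$ such that for every finite set $S \subset \mathbb{N}$ with $H(S) < \infty$, $$I(S) \leq \alpha \cdot H(S) + C\log_2(H(S)+2) + C.$$ Then there is a constant $C'$ such that for every set $S \subset \mathbb{N}$ (finite or infinite) with $H(S) < \infty$, $$I(S) \leq \alpha \cdot H(S) + C'\log_2(H(S)+2) + C'.$$
   Context: A deterministic enumerating machine $D$ is an algorithm that takes a finite binary string $x$ as input and, possibly running forever, outputs (enumerates) natural numbers; the set it enumerates on $x$ is the set of all numbers it ever outputs (possibly infinite). For a set $S\subset\mathbb{N}$, $I_D(S)$ is the minimum length of a binary string $x$ such that $D$ on input $x$ enumerates exactly $S$ ($I_D(S)=\infty$ if none exists). There is a universal machine $D_0$: for every $D$ there is a constant $c$ with $I_{D_0}(S) \le I_D(S)+c$ for all $S$ (note the direction: $D_0$ is at most a constant worse than any $D$). Define $I(S) = I_{D_0}(S)$ for a fixed such universal $D_0$ (well defined up to an additive constant). A probabilistic enumerating machine $M$ is an algorithm that may request arbitrarily many independent uniformly random bits and, possibly running forever, enumerates natural numbers; thus it induces a map from the Cantor space $\{0,1\}^{\mathbb{N}}$ (with the uniform measure) to subsets of $\mathbb{N}$, sending a bit sequence $w$ to the set enumerated when $w$ supplies the random bits. Define $H_M(S) = -\log_2 \Pr[M \text{ enumerates exactly } S]$ (infinite if the probability is $0$). There is an optimal machine $M_0$: for every $M$ there is a constant $c$ with $H_{M_0}(S) \le H_M(S) + c$ for all $S$. Define $H(S) = H_{M_0}(S)$ for a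 fixed such optimal $M_0$ (well defined up to an additive constant). *)

(* Defs.v *)
From mathcomp Require Import all_boot all_order all_algebra.
From mathcomp Require Import all_classical all_reals.
From mathcomp Require Import ereal topology normedtype sequences exp.
Set Implicit Arguments. Unset Strict Implicit. Unset Printing Implicit Defensive.
Import Order.TTheory GRing.Theory Num.Theory.
Local Open Scope classical_set_scope.
Local Open Scope ring_scope.

Inductive prf : Type :=
| PZero : prf
| PSucc : prf
| PProj : nat -> prf
| PComp : prf -> list prf -> prf
| PRec  : prf -> prf -> prf
| PMu   : prf -> prf.

Inductive eval : prf -> seq nat -> nat -> Prop :=
| evZero v : eval PZero v 0
| evSucc x v : eval PSucc (x :: v) x.+1
| evProj i v : (i < size v)%N -> eval (PProj i) v (nth 0%N v i)
| evComp f gs v ws y : evals gs v ws -> eval f ws y -> eval (PComp f gs) v y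
| evRec0 f g v y : eval f v y -> eval (PRec f g) (0%N :: v) y
| evRecS f g n v r y : eval (PRec f g) (n :: v) r ->
    eval g (n :: r :: v) y -> eval (PRec f g) (n.+1 :: v) y
| evMu f v n : eval f (n :: v) 0 ->
    (forall m, (m < n)%N -> exists k, eval f (m :: v) k.+1) -> eval (PMu f) v n
with evals : seq prf -> seq nat -> seq nat -> Prop :=
| evsNil v : evals [::] v [::]
| evsCons g gs v w ws : eval g v w -> evals gs v ws -> evals (g :: gs) v (w :: ws).

Fixpoint code (x : seq bool) : nat :=
  match x with [::] => 1%N | b :: s => ((code s).*2 + b)%N end.

(* Deterministic enumerating machines.  A machine is (the code of) an   *)
(* algorithm D; on input x it enumerates every value eval D [x; t] for *)
(* t = 0,1,2,... on which it halts (dovetailed).  This captures exactly *)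
(* the uniformly computably enumerable families (x |-> set).           *)
Definition det_machine := prf.

Definition enumerates (D : det_machine) (x : seq bool) : set nat :=
  [set n | exists t, eval D [:: code x; t] n].

Section Complexities.
Variable R : realType.
Local Open Scope ereal_scope.

Definition I_D (D : det_machine) (S : set nat) : \bar R :=
  ereal_inf [set (size x)%:R%:E | x in [set x | enumerates D x = S]].

Definition universal_det (D0 : det_machine) : Prop :=
  forall D : det_machine, exists c : R, forall S : set nat,
    I_D D0 S <= I_D D S + c%:E.

(* Probabilistic enumerating machines.  A machine M reads random bits  *)
(* w : nat -> bool; it enumerates n on w iff for some finite prefix    *)
(* sigma of w, the computation of M on sigma (using only the bits of   *)
(* sigma) outputs n, i.e. eval M [code sigma; t] n for some t.         *)
Definition prob_machine := prf.

Definition prefix (w : nat -> bool) (k : nat) : seq bool := mkseq w k.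

Definition penumerates (M : prob_machine) (w : nat -> bool) : set nat :=
  [set n | exists k t, eval M [:: code (prefix w k); t] n].

(* Uniform (fair-coin) measure on Cantor space, as the outer measure
   generated by the cylinders [sigma] with weight 2^-|sigma|; it agrees
   with the product measure on all Borel sets. *)
Definition cylinder (s : seq bool) : set (nat -> bool) :=
  [set w | prefix w (size s) = s].

Definition cantor_measure (A : set (nat -> bool)) : \bar R :=
  ereal_inf [set \sum_(0 <= i <oo) ((2%:R ^- size (c i))%R)%:E
            | c in [set c : nat -> seq bool | A `<=` \bigcup_i cylinder (c i)]].

Definition Prob_enum (M : prob_machine) (S : set nat) : \bar R :=
  cantor_measure [set w | penumerates M w = S].

Definition lgtwo (x : R) : R := (ln x / ln 2)%R.

Definition H_M (M : prob_machine) (S : set nat) : \bar R :=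
  let p := fine (Prob_enum M S) in
  if (0 < p)%R then (- lgtwo p)%:E else +oo.

Definition optimal_prob (M0 : prob_machine) : Prop :=
  forall M : prob_machine, exists c : R, forall S : set nat,
    H_M M0 S <= H_M M S + c%:E.

End Complexities.

Arguments I_D R D S : clear implicits.
Arguments H_M R M S : clear implicits.
Arguments lgtwo R x : clear implicits.

(* Main.v *)
Require Import Defs.
From mathcomp Require Import all_boot all_order all_algebra.
From mathcomp Require Import all_classical all_reals.
From mathcomp Require Import ereal topology normedtype sequences exp.
From mathcomp Require Import zify lra ring.
Import Defs.
Import Order.TTheory GRing.Theory Num.Theory.
Set Implicit Arguments. Unset Strict Implicit. Unset Printing Implicit Defensive.
Local Open Scope classical_set_scope.
Local Open Scope ring_scope.

(** A single probabilistic machine [M] reduces infinite sets to finite ones. Its random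
bits give a self-delimiting code of a pair [(k, L)], at a cost logarithmic in [k + L],
followed by a sequence [w]. On [w] it outputs an increasing sequence of finite sets
[T_w], each of them the part below some [n] of the set [X_w] that [M0]
enumerates on [w], as known at some time. A move replaces [T_w] by a strictly larger
finite set [u], simultaneously for all the [w] whose current approximation is exactly
[u], and it is made only if these [w] have measure at least [2^-k]. After a move, [M]
waits until some program of length at most [L] for [D0] has enumerated exactly [u] at
some time. It cannot wait forever, since [u] would then be a finite output of [M] of
probability about [2^-k], and the hypothesis provides a program of length at most [L],
if [L] is about [alpha k + O(log k)].

Let [S] be infinite and enumerated by [M0] with probability more than [2^-k]. If almost
all [w] with [X_w = S] moved finitely often, then at some time more than [2^-k] of them
would have stopped moving, and would later share the same segment of [S], which can
still be moved to, which contradicts the fairness of the choice of the moves. So some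
[w] with [X_w = S] moves infinitely often, and by the pigeonhole principle a single
program [p] of length at most [L] matches [T_w] at infinitely many times. As [T_w]
converges to [S], the program [p] enumerates [S]. *)

(** * Computable functions *)

Section Pairing.
Local Open Scope nat_scope.

Fixpoint tri n := if n is m.+1 then (m + tri m).+1 else 0.

(** The index of the antidiagonal of Cantor's pairing that contains [z], in the form of a primitive
    recursion so that [pdiag] can copy it. *)
Fixpoint diag z :=
  if z is y.+1 then (if tri (diag y).+1 <= z then (diag y).+1 else diag y) else 0.

Definition cpair a b := tri (a + b) + a.
Definition cfst z := z - tri (diag z).
Definition csnd z := diag z - cfst z.

Lemma tri_diag z : tri (diag z) <= z < tri (diag z).+1.
Proof. elim: z => [|z IH] //=; case: ifP => /=; move: IH => /=; lia. Qed.

Lemma leq_tri m n : m <= n -> tri m <= tri n.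
Proof. by elim: n m => [|n IH] [|m] //= h; have := IH _ h; lia. Qed.

Lemma diag_cpair a b : diag (cpair a b) = a + b.
Proof.
have := tri_diag (cpair a b); rewrite /cpair => /andP[h1 h2].
apply/eqP; rewrite eqn_leq; apply/andP; split; rewrite leqNgt; apply/negP.
  by move=> /leq_tri /=; lia.
by move=> /leq_tri; move: h2 => /=; lia.
Qed.

Lemma cpairK1 a b : cfst (cpair a b) = a.
Proof. by rewrite /cfst diag_cpair /cpair; lia. Qed.

Lemma cpairK2 a b : csnd (cpair a b) = b.
Proof. by rewrite /csnd diag_cpair cpairK1; lia. Qed.

(** This bounds the time stored in a move by the move itself, so that a move below [t] reads only
    bits at positions below [t]. *)
Lemma leq_cfst z : cfst z <= z.
Proof. by rewrite /cfst; lia. Qed.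

(** A polynomial bound is what makes the binary code of a pair logarithmic in its entries. *)
Lemma cpair_leq a b : cpair a b <= (a + b).+1 ^ 2.
Proof.
rewrite /cpair; have : tri (a + b) <= (a + b) * (a + b).
  by elim: (a + b) => //= n; lia.
by rewrite expnS expn1; lia.
Qed.

End Pairing.

(** * Programs for elementary arithmetic and pairing *)

Section EvalLemmas.
Local Open Scope nat_scope.

Lemma eval_comp1 f g v a y :
  eval g v a -> eval f [:: a] y -> eval (PComp f [:: g]) v y.
Proof. by move=> h; apply: evComp; do !constructor. Qed.

Lemma eval_comp2 f g1 g2 v a b y :
  eval g1 v a -> eval g2 v b -> eval f [:: a; b] y ->
  eval (PComp f [:: g1; g2]) v y.
Proof. by move=> h1 h2; apply: evComp; do !constructor. Qed.

Lemma eval_comp3 f g1 g2 g3 v a b c y :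
  eval g1 v a -> eval g2 v b -> eval g3 v c -> eval f [:: a; b; c] y ->
  eval (PComp f [:: g1; g2; g3]) v y.
Proof. by move=> h1 h2 h3; apply: evComp; do !constructor. Qed.

Lemma eval_proj i v x : i < size v -> nth 0 v i = x -> eval (PProj i) v x.
Proof. by move=> h <-; apply: evProj. Qed.

Lemma eval_rec f g v (F : nat -> nat) :
  eval f v (F 0) -> (forall n, eval g [:: n, F n & v] (F n.+1)) ->
  forall n, eval (PRec f g) (n :: v) (F n).
Proof.
move=> h0 hS; elim=> [|n IH]; first by constructor.
by apply: evRecS IH _.
Qed.

Definition padd := PRec (PProj 0) (PComp PSucc [:: PProj 1]).
Lemma eval_padd m n : eval padd [:: m; n] (m + n).
Proof.
apply: (eval_rec (F := fun m => m + n)); first exact: eval_proj.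
by move=> k; apply: eval_comp1; [exact: eval_proj|constructor].
Qed.

Definition ppred := PRec PZero (PProj 0).
Lemma eval_ppred m : eval ppred [:: m] m.-1.
Proof. by apply: (eval_rec (F := predn)) => [|k]; [constructor|exact: eval_proj]. Qed.

Definition pminus := PRec (PProj 0) (PComp ppred [:: PProj 1]).
Lemma eval_pminus m n : eval pminus [:: m; n] (n - m).
Proof.
apply: (eval_rec (F := fun m => n - m)); first by rewrite subn0; exact: eval_proj.
by move=> k; rewrite subnS; apply: eval_comp1; [exact: eval_proj|exact: eval_ppred].
Qed.

Definition ptri := PRec PZero (PComp PSucc [:: padd]).
Lemma eval_ptri n : eval ptri [:: n] (tri n).
Proof.
apply: (eval_rec (F := tri)); first by constructor.
move=> k; apply: eval_comp1; last by constructor.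
exact: eval_padd.
Qed.

(** The recursive step sees the list [[:: n; r; x; y]], in which [y] has index 3. *)
Definition pcond := PRec (PProj 0) (PProj 3).
Lemma eval_pcond n x y : eval pcond [:: n; x; y] (if n is 0 then x else y).
Proof.
apply: (eval_rec (F := fun n => if n is 0 then x else y)); first exact: eval_proj.
by move=> k; exact: eval_proj.
Qed.

Definition pdiag :=
  PRec PZero (PComp pcond [:: PComp pminus [:: PComp PSucc [:: PProj 0];
                                             PComp ptri [:: PComp PSucc [:: PProj 1]]];
                              PComp PSucc [:: PProj 1]; PProj 1]).
Lemma eval_pdiag n : eval pdiag [:: n] (diag n).
Proof.
apply: (eval_rec (F := diag)); first by constructor.
move=> k; apply: eval_comp3.
- apply: eval_comp2; last exact: eval_pminus.
    by apply: eval_comp1; [exact: eval_proj|constructor].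
  apply: eval_comp1; last exact: eval_ptri.
  by apply: eval_comp1; [exact: eval_proj|constructor].
- by apply: eval_comp1; [exact: eval_proj|constructor].
- exact: eval_proj.
- rewrite -[diag k.+1]/(if tri (diag k).+1 - k.+1 == 0 then (diag k).+1 else diag k).
  case e : (_ - _) => [|j]; rewrite ?eqxx.
    exact: (eval_pcond 0).
  exact: (eval_pcond j.+1).
Qed.

Definition ppair := PComp padd [:: PComp ptri [:: padd]; PProj 0].
Lemma eval_ppair a b : eval ppair [:: a; b] (cpair a b).
Proof.
apply: eval_comp2; last exact: eval_padd.
  by apply: eval_comp1; [exact: eval_padd|exact: eval_ptri].
exact: eval_proj.
Qed.

Definition pfst := PComp pminus [:: PComp ptri [:: pdiag]; PProj 0].
Lemma eval_pfst z : eval pfst [:: z] (cfst z).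
Proof.
apply: eval_comp2; last exact: eval_pminus.
  by apply: eval_comp1; [exact: eval_pdiag|exact: eval_ptri].
exact: eval_proj.
Qed.

Definition psnd := PComp pminus [:: pfst; pdiag].
Lemma eval_psnd z : eval psnd [:: z] (csnd z).
Proof.
by apply: eval_comp2; [exact: eval_pfst|exact: eval_pdiag|exact: eval_pminus].
Qed.

End EvalLemmas.

(** Programs act on codes directly, so a coding comes without a decoder; injectivity is what lets
    equality be tested on codes. *)
Class Enc (T : Type) := { enc : T -> nat; enc_inj : injective enc }.

Section Encodings.
Local Open Scope nat_scope.

Lemma nat_enc_inj : injective (fun n : nat => n).
Proof. by []. Qed.
#[export] Instance Enc_nat : Enc nat := Build_Enc nat_enc_inj.

Lemma bool_enc_inj : injective nat_of_bool.
Proof. by case=> [] []. Qed.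
#[export] Instance Enc_bool : Enc bool := Build_Enc bool_enc_inj.

Lemma prod_enc_inj A B {EA : Enc A} {EB : Enc B} :
  injective (fun x : A * B => cpair (enc x.1) (enc x.2)).
Proof.
move=> [a b] [c d] /= h; congr pair; apply: enc_inj.
  by rewrite -(cpairK1 (enc a) (enc b)) h cpairK1.
by rewrite -(cpairK2 (enc a) (enc b)) h cpairK2.
Qed.
#[export] Instance Enc_prod A B {EA : Enc A} {EB : Enc B} : Enc (A * B) :=
  Build_Enc (@prod_enc_inj A B EA EB).

Fixpoint enc_seq A {EA : Enc A} (s : seq A) : nat :=
  if s is x :: s' then (cpair (enc x) (enc_seq s')).+1 else 0.

Lemma enc_seq_inj A {EA : Enc A} : injective (@enc_seq A EA).
Proof.
elim=> [|x s IH] [|y s'] //= [h]; congr cons.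
  by apply: enc_inj; rewrite -(cpairK1 (enc x) (enc_seq s)) h cpairK1.
by apply: IH; rewrite -(cpairK2 (enc x) (enc_seq s)) h cpairK2.
Qed.
#[export] Instance Enc_seq A {EA : Enc A} : Enc (seq A) :=
  Build_Enc (@enc_seq_inj A EA).

(** The code of a list can therefore serve as the number of iterations of a loop over it. *)
Lemma size_enc_seq A {EA : Enc A} (s : seq A) : size s <= enc s.
Proof.
elim: s => //= x s; rewrite ltnS => h; apply: leq_trans h _.
have : enc x + enc_seq s <= tri (enc x + enc_seq s) by elim: (_ + _) => //= n; lia.
by rewrite /cpair; lia.
Qed.

End Encodings.

Definition computable A B {EA : Enc A} {EB : Enc B} (f : A -> B) :=
  exists p, forall x, eval p [:: enc x] (enc (f x)).

(** * Closure properties of computable functions *)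

Section Combinators.
Local Open Scope nat_scope.
Context {X : Type} {EX : Enc X}.

Lemma c_id : computable (fun x : X => x).
Proof. by exists (PProj 0) => x; exact: eval_proj. Qed.

Lemma c_const B {EB : Enc B} (b : B) : computable (fun _ : X => b).
Proof.
exists (iter (enc b) (fun p => PComp PSucc [:: p]) PZero) => x.
elim: (enc b) => [|n IH] /=; first by constructor.
by apply: eval_comp1 IH _; constructor.
Qed.

Lemma c_comp A B {EA : Enc A} {EB : Enc B} (g : A -> B) (f : X -> A) :
  computable g -> computable f -> computable (fun x => g (f x)).
Proof.
move=> [q hq] [p hp]; exists (PComp q [:: p]) => x.
exact: eval_comp1 (hp x) (hq _).
Qed.

Lemma c_pair A B {EA : Enc A} {EB : Enc B} (f : X -> A) (g : X -> B) :
  computable f -> computable g -> computable (fun x => (f x, g x)).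
Proof.
move=> [p hp] [q hq]; exists (PComp ppair [:: p; q]) => x.
exact: eval_comp2 (hp x) (hq x) (eval_ppair _ _).
Qed.

Lemma c_fst A B {EA : Enc A} {EB : Enc B} (f : X -> A * B) :
  computable f -> computable (fun x => (f x).1).
Proof.
move=> [p hp]; exists (PComp pfst [:: p]) => x.
apply: eval_comp1 (hp x) _.
have -> : enc (f x).1 = cfst (enc (f x)) by rewrite /= cpairK1.
exact: eval_pfst.
Qed.

Lemma c_snd A B {EA : Enc A} {EB : Enc B} (f : X -> A * B) :
  computable f -> computable (fun x => (f x).2).
Proof.
move=> [p hp]; exists (PComp psnd [:: p]) => x.
apply: eval_comp1 (hp x) _.
have -> : enc (f x).2 = csnd (enc (f x)) by rewrite /= cpairK2.
exact: eval_psnd.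
Qed.

(** Primitive recursion with the parameter [x] carried as last argument; the bounded loops on data
    below all reduce to it. *)
Lemma c_iteri B {EB : Enc B} (n : X -> nat) (a : X -> B) (F : X -> nat -> B -> B) :
  computable n -> computable a ->
  computable (fun z : X * (nat * B) => F z.1 z.2.1 z.2.2) ->
  computable (fun x => iteri (n x) (F x) (a x)).
Proof.
move=> [pn hn] [pa ha] [pF hF].
pose st := PComp pF [:: PComp ppair [:: PProj 2; PComp ppair [:: PProj 0; PProj 1]]].
exists (PComp (PRec pa st) [:: pn; PProj 0]) => x.
apply: (eval_comp2 (hn x)); first exact: eval_proj.
apply: (eval_rec (F := fun n => enc (iteri n (F x) (a x)))); first exact: ha.
move=> k; apply: (@eval_comp1 _ _ _ (enc (x, (k, iteri k (F x) (a x))))).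
  apply: eval_comp2; last exact: eval_ppair.
    exact: eval_proj.
  by apply: eval_comp2; [exact: eval_proj|exact: eval_proj|exact: eval_ppair].
exact: (hF (x, (k, iteri k (F x) (a x)))).
Qed.

(** Both branches get evaluated, which is harmless because computable functions are total here. *)
Lemma c_if B {EB : Enc B} (b : X -> bool) (f g : X -> B) :
  computable b -> computable f -> computable g ->
  computable (fun x => if b x then f x else g x).
Proof.
move=> [pb hb] [pf hf] [pg hg]; exists (PComp pcond [:: pb; pg; pf]) => x.
apply: (eval_comp3 (hb x) (hg x) (hf x)).
by case: (b x); [exact: (eval_pcond 1)|exact: (eval_pcond 0)].
Qed.

Lemma c_succ (f : X -> nat) : computable f -> computable (fun x => (f x).+1).
Proof.
move=> [p hp]; exists (PComp PSucc [:: p]) => x.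
by apply: eval_comp1 (hp x) _; constructor.
Qed.

Lemma c_eqfun A B {EA : Enc A} {EB : Enc B} (f g : A -> B) :
  f =1 g -> computable f -> computable g.
Proof. by move=> h [p hp]; exists p => x; rewrite -h. Qed.

Lemma c_enc B {EB : Enc B} (f : X -> B) :
  computable f -> computable (fun x => enc (f x)).
Proof. by move=> [p hp]; exists p. Qed.

End Combinators.

Section Arithmetic.
Local Open Scope nat_scope.

Lemma c_natcase X {EX : Enc X} B {EB : Enc B} (f : X -> nat) (a : X -> B) (F : X -> nat -> B) :
  computable f -> computable a -> computable (fun z : X * nat => F z.1 z.2) ->
  computable (fun x => if f x is m.+1 then F x m else a x).
Proof.
move=> hf ha hF.
apply: (@c_eqfun _ _ _ _ (fun x => iteri (f x) (fun i _ => F x i) (a x))).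
  by move=> x; case: (f x).
apply: c_iteri => //.
apply: (c_comp (g := fun z : X * nat => F z.1 z.2)
  (f := fun z : X * (nat * B) => (z.1, z.2.1))) => //.
by apply: c_pair; [apply: c_fst|apply: c_fst; apply: c_snd]; exact: c_id.
Qed.

Lemma c_iter X {EX : Enc X} B {EB : Enc B} (f : X -> nat) (a : X -> B) (F : X -> B -> B) :
  computable f -> computable a -> computable (fun z : X * B => F z.1 z.2) ->
  computable (fun x => iter (f x) (F x) (a x)).
Proof.
move=> hf ha hF.
apply: (@c_eqfun _ _ _ _ (fun x => iteri (f x) (fun _ => F x) (a x))).
  by move=> x; elim: (f x) => //= n ->.
apply: c_iteri => //.
apply: (c_comp (g := fun z : X * B => F z.1 z.2)
  (f := fun z : X * (nat * B) => (z.1, z.2.2))) => //.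
by apply: c_pair; [apply: c_fst|apply: c_snd; apply: c_snd]; exact: c_id.
Qed.

Lemma c_pred X {EX : Enc X} (f : X -> nat) : computable f -> computable (fun x => (f x).-1).
Proof.
move=> hf; apply: (@c_eqfun _ _ _ _ (fun x => if f x is m.+1 then m else 0)).
  by move=> x; case: (f x).
by apply: c_natcase => //; [exact: c_const|apply: c_snd; exact: c_id].
Qed.

Lemma c_addn X {EX : Enc X} (f g : X -> nat) :
  computable f -> computable g -> computable (fun x => f x + g x).
Proof.
move=> [p hp] [q hq]; exists (PComp padd [:: p; q]) => x.
exact: eval_comp2 (hp x) (hq x) (eval_padd _ _).
Qed.

Lemma c_subn X {EX : Enc X} (f g : X -> nat) :
  computable f -> computable g -> computable (fun x => f x - g x).
Proof.
move=> [p hp] [q hq]; exists (PComp pminus [:: q; p]) => x.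
exact: eval_comp2 (hq x) (hp x) (eval_pminus _ _).
Qed.

Lemma c_muln X {EX : Enc X} (f g : X -> nat) :
  computable f -> computable g -> computable (fun x => f x * g x).
Proof.
move=> hf hg; apply: (@c_eqfun _ _ _ _ (fun x => iter (f x) (addn (g x)) 0)).
  by move=> x; rewrite iter_addn_0 mulnC.
apply: c_iter => //; first exact: c_const.
by apply: c_addn; [apply: c_comp; [exact: hg|apply: c_fst; exact: c_id]|apply: c_snd; exact: c_id].
Qed.

Lemma c_expn2 X {EX : Enc X} (f : X -> nat) : computable f -> computable (fun x => 2 ^ f x).
Proof.
move=> hf; apply: (@c_eqfun _ _ _ _ (fun x => iter (f x) (fun y => y + y) 1)).
  by move=> x; elim: (f x) => //= n ->; rewrite expnS; lia.
apply: c_iter => //; first exact: c_const.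
by apply: c_addn; apply: c_snd; exact: c_id.
Qed.

Lemma c_eq0 X {EX : Enc X} (f : X -> nat) : computable f -> computable (fun x => f x == 0).
Proof.
move=> hf; apply: (@c_eqfun _ _ _ _ (fun x => if f x is m.+1 then false else true)).
  by move=> x; case: (f x).
by apply: c_natcase => //; exact: c_const.
Qed.

Lemma c_leq X {EX : Enc X} (f g : X -> nat) :
  computable f -> computable g -> computable (fun x => f x <= g x).
Proof. by move=> hf hg; rewrite /leq; apply: c_eq0; exact: c_subn. Qed.

Lemma c_ltn X {EX : Enc X} (f g : X -> nat) :
  computable f -> computable g -> computable (fun x => f x < g x).
Proof. by move=> hf hg; apply: c_leq => //; exact: c_succ. Qed.

Lemma c_negb X {EX : Enc X} (b : X -> bool) : computable b -> computable (fun x => ~~ b x).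
Proof.
move=> hb; apply: (@c_eqfun _ _ _ _ (fun x => if b x then false else true)).
  by move=> x; case: (b x).
by apply: c_if => //; exact: c_const.
Qed.

Lemma c_andb X {EX : Enc X} (b c : X -> bool) :
  computable b -> computable c -> computable (fun x => b x && c x).
Proof. by move=> hb hc; apply: c_if => //; exact: c_const. Qed.

Lemma c_eq X {EX : Enc X} (T : eqType) {ET : Enc T} (f g : X -> T) :
  computable f -> computable g -> computable (fun x => f x == g x).
Proof.
move=> /c_enc hf /c_enc hg.
apply: (@c_eqfun _ _ _ _ (fun x => (enc (f x) <= enc (g x)) && (enc (g x) <= enc (f x)))).
  by move=> x; rewrite -eqn_leq (inj_eq enc_inj).
by apply: c_andb; exact: c_leq.
Qed.

Lemma c_odd X {EX : Enc X} (f : X -> nat) : computable f -> computable (fun x => odd (f x)).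
Proof.
move=> hf; apply: (@c_eqfun _ _ _ _ (fun x => iter (f x) negb false)).
  by move=> x; elim: (f x) => //= n ->.
apply: c_iter => //; first exact: c_const.
by apply: c_negb; apply: c_snd; exact: c_id.
Qed.

Lemma c_nat_of_bool X {EX : Enc X} (b : X -> bool) :
  computable b -> computable (fun x => nat_of_bool (b x)).
Proof. exact: c_enc. Qed.

Lemma c_half X {EX : Enc X} (f : X -> nat) : computable f -> computable (fun x => (f x)./2).
Proof.
move=> hf.
apply: (@c_eqfun _ _ _ _ (fun x => iteri (f x) (fun i h => odd i + h) 0)).
  by move=> x; elim: (f x) => //= n ->; rewrite uphalf_half.
apply: c_iteri => //; first exact: c_const.
apply: c_addn; last by do 2! apply: c_snd; exact: c_id.
by apply: c_nat_of_bool; apply: c_odd; apply: c_fst; apply: c_snd; exact: c_id.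
Qed.

Lemma c_cfst X {EX : Enc X} (f : X -> nat) : computable f -> computable (fun x => cfst (f x)).
Proof. by apply: c_comp; exists pfst => x; exact: eval_pfst. Qed.

Lemma c_csnd X {EX : Enc X} (f : X -> nat) : computable f -> computable (fun x => csnd (f x)).
Proof. by apply: c_comp; exists psnd => x; exact: eval_psnd. Qed.

End Arithmetic.

Section Lists.
Local Open Scope nat_scope.

Lemma c_cons X A {EX : Enc X} {EA : Enc A} (a : X -> A) (s : X -> seq A) :
  computable a -> computable s -> computable (fun x => a x :: s x).
Proof.
move=> ha hs; have [p hp] := c_pair ha hs.
by exists (PComp PSucc [:: p]) => x; apply: eval_comp1 (hp x) _; constructor.
Qed.

Lemma c_nilp X A {EX : Enc X} {EA : Enc A} (s : X -> seq A) :
  computable s -> computable (fun x => nilp (s x)).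
Proof.
move=> /c_enc hs; apply: (@c_eqfun _ _ _ _ (fun x => enc (s x) == 0)).
  by move=> x; case: (s x).
exact: c_eq0.
Qed.

Lemma c_behead X A {EX : Enc X} {EA : Enc A} (s : X -> seq A) :
  computable s -> computable (fun x => behead (s x)).
Proof.
move=> hs; have [p hp] := c_csnd (c_pred (c_enc hs)); exists p => x.
have -> : enc (behead (s x)) = csnd (enc (s x)).-1; last exact: hp.
by case: (s x) => //= y t; rewrite cpairK2.
Qed.

Lemma c_head X A {EX : Enc X} {EA : Enc A} (a : X -> A) (s : X -> seq A) :
  computable a -> computable s -> computable (fun x => head (a x) (s x)).
Proof.
move=> [pa ha] hs; have [p hp] := c_cfst (c_pred (c_enc hs)).
have [q hq] := c_enc hs.
exists (PComp pcond [:: q; pa; p]) => x.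
apply: (eval_comp3 (hq x) (ha x) (hp x)).
have -> : enc (head (a x) (s x)) =
    if enc (s x) is 0 then enc (a x) else cfst (enc (s x)).-1.
  by case: (s x) => //= y t; rewrite cpairK1.
exact: eval_pcond.
Qed.

Lemma c_seqcase X A {EX : Enc X} {EA : Enc A} B {EB : Enc B} (x0 : A)
    (s : X -> seq A) (a : X -> B)
    (F : X -> A -> seq A -> B) :
  computable s -> computable a ->
  computable (fun z : X * (A * seq A) => F z.1 z.2.1 z.2.2) ->
  computable (fun x => if s x is y :: t then F x y t else a x).
Proof.
move=> hs ha hF.
apply: (@c_eqfun _ _ _ _ (fun x =>
    if nilp (s x) then a x else F x (head x0 (s x)) (behead (s x)))).
  by move=> x; case: (s x).
apply: c_if => //; first exact: c_nilp.
apply: (c_comp (g := fun z : X * (A * seq A) => F z.1 z.2.1 z.2.2)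
               (f := fun x => (x, (head x0 (s x), behead (s x))))) => //.
apply: c_pair; first exact: c_id.
by apply: c_pair; [apply: c_head => //; exact: c_const|exact: c_behead].
Qed.

End Lists.

Section Folds.
Local Open Scope nat_scope.

(** The fold is an iteration on pairs of a remaining list and an accumulator. Its step leaves the
    accumulator alone once the list is empty, so any number of steps at least the length gives the
    same result. *)
Lemma c_foldl X A {EX : Enc X} {EA : Enc A} B {EB : Enc B} (x0 : A)
    (s : X -> seq A) (a : X -> B)
    (F : X -> B -> A -> B) :
  computable s -> computable a ->
  computable (fun z : X * (B * A) => F z.1 z.2.1 z.2.2) ->
  computable (fun x => foldl (F x) (a x) (s x)).
Proof.
move=> hs ha hF.
pose st x (z : seq A * B) :=
  if z.1 is y :: t then (t, F x z.2 y) else ([::], z.2).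
apply: (@c_eqfun _ _ _ _ (fun x => (iter (enc (s x)) (st x) (s x, a x)).2)).
  move=> x /=.
  have h : forall n t b, size t <= n -> (iter n (st x) (t, b)).2 = foldl (F x) b t.
    by elim=> [|k IH] [|y t] b // hk; rewrite iterSr IH.
  exact: h (size_enc_seq (s x)).
apply: c_snd; apply: c_iter; first exact: c_enc.
  exact: c_pair.
apply: (@c_seqcase _ A _ _ _ _ x0 (fun z : X * (seq A * B) => z.2.1)
  (fun z => ([::], z.2.2)) (fun z y t => (t, F z.1 z.2.2 y))).
- by apply: c_fst; apply: c_snd; exact: c_id.
- by apply: c_pair; [exact: c_const|apply: c_snd; apply: c_snd; exact: c_id].
apply: c_pair; first by apply: c_snd; apply: c_snd; exact: c_id.
apply: (c_comp (g := fun z : X * (B * A) => F z.1 z.2.1 z.2.2)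
  (f := fun z : X * (seq A * B) * (A * seq A) => (z.1.1, (z.1.2.2, z.2.1)))) => //.
apply: c_pair; first by do 2! apply: c_fst; exact: c_id.
apply: c_pair; first by do 2! apply: c_snd; apply: c_fst; exact: c_id.
by apply: c_fst; apply: c_snd; exact: c_id.
Qed.

Lemma c_rev X A {EX : Enc X} {EA : Enc A} (x0 : A) (s : X -> seq A) :
  computable s -> computable (fun x => rev (s x)).
Proof.
move=> hs; apply: (@c_eqfun _ _ _ _ (fun x => foldl (fun t y => y :: t) [::] (s x))).
  by move=> x; rewrite /rev; elim: (s x) [::] => //=.
apply: (c_foldl x0) => //; first exact: c_const.
by apply: c_cons; [apply: c_snd; apply: c_snd|apply: c_fst; apply: c_snd]; exact: c_id.
Qed.

Lemma c_foldr X A {EX : Enc X} {EA : Enc A} B {EB : Enc B} (x0 : A)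
    (s : X -> seq A) (a : X -> B)
    (F : X -> A -> B -> B) :
  computable s -> computable a ->
  computable (fun z : X * (A * B) => F z.1 z.2.1 z.2.2) ->
  computable (fun x => foldr (F x) (a x) (s x)).
Proof.
move=> hs ha hF.
apply: (@c_eqfun _ _ _ _ (fun x => foldl (fun b y => F x y b) (a x) (rev (s x)))).
  by move=> x; rewrite foldl_rev.
apply: (c_foldl x0) => //; first exact: c_rev.
apply: (c_comp (g := fun z : X * (A * B) => F z.1 z.2.1 z.2.2)
  (f := fun z : X * (B * A) => (z.1, (z.2.2, z.2.1)))) => //.
apply: c_pair; first by apply: c_fst; exact: c_id.
by apply: c_pair; [do 2! apply: c_snd|apply: c_fst; apply: c_snd]; exact: c_id.
Qed.

Lemma c_cat X A {EX : Enc X} {EA : Enc A} (x0 : A) (s t : X -> seq A) :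
  computable s -> computable t -> computable (fun x => s x ++ t x).
Proof.
move=> hs ht; apply: (@c_eqfun _ _ _ _ (fun x => foldr cons (t x) (s x))).
  by move=> x; elim: (s x) => //= y u ->.
apply: (c_foldr x0) => //.
by apply: c_cons; [apply: c_fst|apply: c_snd]; apply: c_snd; exact: c_id.
Qed.

Lemma c_map X A {EX : Enc X} {EA : Enc A} B {EB : Enc B} (x0 : A)
    (s : X -> seq A) (F : X -> A -> B) :
  computable s -> computable (fun z : X * A => F z.1 z.2) ->
  computable (fun x => [seq F x y | y <- s x]).
Proof.
move=> hs hF.
apply: (@c_eqfun _ _ _ _ (fun x => foldr (fun y t => F x y :: t) [::] (s x))).
  by move=> x; elim: (s x) => //= y u ->.
apply: (c_foldr x0) => //; first exact: c_const.
apply: c_cons; last by do 2! apply: c_snd; exact: c_id.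
apply: (c_comp (g := fun z : X * A => F z.1 z.2)
  (f := fun z : X * (A * seq B) => (z.1, z.2.1))) => //.
by apply: c_pair; [apply: c_fst|apply: c_fst; apply: c_snd]; exact: c_id.
Qed.

Lemma c_filter X A {EX : Enc X} {EA : Enc A} (x0 : A) (s : X -> seq A) (F : X -> A -> bool) :
  computable s -> computable (fun z : X * A => F z.1 z.2) ->
  computable (fun x => [seq y <- s x | F x y]).
Proof.
move=> hs hF.
apply: (@c_eqfun _ _ _ _ (fun x => foldr (fun y t => if F x y then y :: t else t) [::] (s x))).
  by move=> x; elim: (s x) => //= y u ->.
apply: (c_foldr x0) => //; first exact: c_const.
apply: c_if; last by do 2! apply: c_snd; exact: c_id.
  apply: (c_comp (g := fun z : X * A => F z.1 z.2)
    (f := fun z : X * (A * seq A) => (z.1, z.2.1))) => //.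
  by apply: c_pair; [apply: c_fst|apply: c_fst; apply: c_snd]; exact: c_id.
by apply: c_cons; [apply: c_fst|apply: c_snd]; apply: c_snd; exact: c_id.
Qed.

Lemma c_size X A {EX : Enc X} {EA : Enc A} (x0 : A) (s : X -> seq A) :
  computable s -> computable (fun x => size (s x)).
Proof.
move=> hs; apply: (@c_eqfun _ _ _ _ (fun x => foldr (fun _ n => n.+1) 0 (s x))) => //.
apply: (c_foldr x0) => //; first exact: c_const.
by apply: c_succ; do 2! apply: c_snd; exact: c_id.
Qed.

Lemma c_count X A {EX : Enc X} {EA : Enc A} (x0 : A) (s : X -> seq A) (F : X -> A -> bool) :
  computable s -> computable (fun z : X * A => F z.1 z.2) ->
  computable (fun x => count (F x) (s x)).
Proof.
move=> hs hF; apply: (@c_eqfun _ _ _ _ (fun x => size [seq y <- s x | F x y])).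
  by move=> x; rewrite size_filter.
by apply: (c_size x0); exact: c_filter.
Qed.

Lemma c_has X A {EX : Enc X} {EA : Enc A} (x0 : A) (s : X -> seq A) (F : X -> A -> bool) :
  computable s -> computable (fun z : X * A => F z.1 z.2) ->
  computable (fun x => has (F x) (s x)).
Proof.
move=> hs hF; apply: (@c_eqfun _ _ _ _ (fun x => 0 < count (F x) (s x))).
  by move=> x; rewrite has_count.
by apply: c_ltn; [exact: c_const|exact: (c_count x0 hs hF)].
Qed.

Lemma c_all X A {EX : Enc X} {EA : Enc A} (x0 : A) (s : X -> seq A) (F : X -> A -> bool) :
  computable s -> computable (fun z : X * A => F z.1 z.2) ->
  computable (fun x => all (F x) (s x)).
Proof.
move=> hs hF; apply: (@c_eqfun _ _ _ _ (fun x => ~~ has (fun y => ~~ F x y) (s x))).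
  by move=> x; rewrite -all_predC; apply: eq_all => y /=; rewrite negbK.
by apply: c_negb; apply: (c_has x0) => //; exact: c_negb.
Qed.

Lemma c_drop X A {EX : Enc X} {EA : Enc A} (n : X -> nat) (s : X -> seq A) :
  computable n -> computable s -> computable (fun x => drop (n x) (s x)).
Proof.
move=> hn hs; apply: (@c_eqfun _ _ _ _ (fun x => iter (n x) behead (s x))).
  by move=> x; elim: (n x) (s x) => [|k IH] t; rewrite ?drop0 // iterSr IH -drop1 drop_drop addn1.
by apply: c_iter => //; apply: c_behead; apply: c_snd; exact: c_id.
Qed.

Lemma c_nth X A {EX : Enc X} {EA : Enc A} (a : A) (s : X -> seq A) (n : X -> nat) :
  computable s -> computable n -> computable (fun x => nth a (s x) (n x)).
Proof.
move=> hs hn; apply: (@c_eqfun _ _ _ _ (fun x => head a (drop (n x) (s x)))).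
  by move=> x; rewrite -nth0 nth_drop addn0.
by apply: c_head; [exact: c_const|exact: c_drop].
Qed.

End Folds.

Section MoreLists.
Local Open Scope nat_scope.

Lemma c_iota X {EX : Enc X} (n : X -> nat) :
  computable n -> computable (fun x => iota 0 (n x)).
Proof.
move=> hn; apply: (@c_eqfun _ _ _ _ (fun x => iteri (n x) (fun i s => s ++ [:: i]) [::])).
  by move=> x; elim: (n x) => // k IH; rewrite iteriS IH -[in RHS]addn1 iotaD.
apply: c_iteri => //; first exact: c_const.
apply: (c_cat 0); first by do 2! apply: c_snd; exact: c_id.
by apply: c_cons; [apply: c_fst; apply: c_snd; exact: c_id|exact: c_const].
Qed.

Lemma c_mkseq X {EX : Enc X} A {EA : Enc A} (n : X -> nat) (F : X -> nat -> A) :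
  computable n -> computable (fun z : X * nat => F z.1 z.2) ->
  computable (fun x => mkseq (F x) (n x)).
Proof. by move=> hn hF; apply: (c_map 0) => //; exact: c_iota. Qed.

Lemma c_mem X {EX : Enc X} (a : X -> nat) (s : X -> seq nat) :
  computable a -> computable s -> computable (fun x => a x \in s x).
Proof.
move=> ha hs; apply: (@c_eqfun _ _ _ _ (fun x => has (fun y => y == a x) (s x))).
  by move=> x; rewrite has_pred1.
apply: (c_has 0) => //; apply: c_eq; first by apply: c_snd; exact: c_id.
by apply: (c_comp ha); apply: c_fst; exact: c_id.
Qed.

Lemma c_subseq_mem X {EX : Enc X} (s t : X -> seq nat) :
  computable s -> computable t -> computable (fun x => all (mem (t x)) (s x)).
Proof.
move=> hs ht; apply: (c_all 0) => //; apply: c_mem; first by apply: c_snd; exact: c_id.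
by apply: (c_comp ht); apply: c_fst; exact: c_id.
Qed.

End MoreLists.

(* Otherwise [apply:] below unfolds these to match unrelated combinators. *)
#[local] Opaque computable cfst csnd cpair.

Ltac cstep :=
  first [ progress cbv beta
        | apply: c_id | apply: c_const
        | match goal with H : computable _ |- _ => exact: H end
        | apply: c_cons | apply: c_fst | apply: c_snd | apply: c_pair
        | apply: c_andb | apply: c_negb
        | apply: c_if
        | apply: c_cfst | apply: c_csnd
        | apply: c_eq0 | apply: c_ltn | apply: c_leq | apply: c_eq
        | apply: c_addn | apply: c_subn | apply: c_muln
        | apply: c_expn2
        | apply: c_half | apply: c_odd | apply: c_nat_of_bool
        | apply: c_pred | apply: c_succ
        | apply: c_drop
        | apply: c_iota | apply: c_mkseq
        | apply: c_subseq_mem | apply: c_mem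
        | match goal with H : computable _ |- _ => apply: (c_comp H) end ].
Ltac ccomp := repeat cstep.

(** * Approximate evaluation with fuel *)

Section Evaluation.
Local Open Scope nat_scope.

(** Programs are nested through lists; this form of induction also reaches the members of the list
    under [PComp]. *)
Lemma prf_ind_nested (P : prf -> Prop) :
  P PZero -> P PSucc -> (forall i, P (PProj i)) ->
  (forall f gs, P f -> foldr (fun g => and (P g)) True gs -> P (PComp f gs)) ->
  (forall f g, P f -> P g -> P (PRec f g)) ->
  (forall f, P f -> P (PMu f)) -> forall f, P f.
Proof.
move=> hZ hS hP hC hR hM; fix IH 1 => -[||i|f gs|f g|f].
- exact: hZ.
- exact: hS.
- exact: hP.
- apply: hC; first exact: IH.
  by elim: gs => [|g gs IHgs] /=; [|split; first exact: IH].
- by apply: hR; exact: IH.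
- by apply: hM; exact: IH.
Qed.

(* The result [n.+2] means that [n] is the least argument at which [F] is [1],
   the result [1] that [F] vanishes earlier, and [0] that the search goes on. *)
Definition musearch s (F : nat -> nat) :=
  iteri s (fun m acc => if acc == 0 then
    (if F m == 0 then 1 else if F m == 1 then m.+2 else 0) else acc) 0.

(* [ev s f v] is [y.+1] if the computation of [f] on [v] is seen to halt with
   value [y] when unbounded searches are cut at [s], and [0] otherwise. *)
Fixpoint ev s f v {struct f} : nat :=
  match f with
  | PZero => 1
  | PSucc => if v is x :: _ then x.+2 else 0
  | PProj i => if i < size v then (nth 0 v i).+1 else 0
  | PComp f gs => let ws := [seq ev s g v | g <- gs] in
      if all (leq 1) ws then ev s f [seq w.-1 | w <- ws] else 0
  | PRec f g => if v is n :: v' then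
      iteri n (fun m r => if r == 0 then 0 else ev s g [:: m, r.-1 & v']) (ev s f v')
      else 0
  | PMu f => (musearch s (fun m => ev s f (m :: v))).-1
  end.

(** When [F] comes from [ev], [F m = 1] is a halt with value 0 and [1 < F m] a halt with a nonzero
    value, as in the rule [evMu]. *)
Lemma musearch_spec s F :
  (musearch s F = 0 -> forall m, m < s -> 1 < F m) /\
  (forall n, musearch s F = n.+2 -> F n = 1 /\ forall m, m < n -> 1 < F m).
Proof.
rewrite /musearch; elim: s => [|s [IH0 IHS]] //=.
case: eqP => [/IH0 h|hne]; last by split.
case: eqP => // h0; case: eqP => h1; split => //.
  by move=> n [<-]; split.
move=> _ m; rewrite ltnS leq_eqVlt => /orP[/eqP ->|/h] //.
by case: (F s) h0 h1 => // -[].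
Qed.

Lemma musearch_complete s F n : F n = 1 -> (forall m, m < n -> 1 < F m) ->
  n < s -> musearch s F = n.+2.
Proof.
move=> hn hm; have h0 k : k <= n -> musearch k F = 0.
  rewrite /musearch; elim: k => //= k IH hk; rewrite (IH (ltnW hk)) eqxx.
  by have := hm k hk; case: (F k) => // -[].
elim: s => // s IH; rewrite ltnS leq_eqVlt => /orP[/eqP <-|/IH h].
  by rewrite /musearch iteriS -/(musearch n F) h0 //= hn.
by rewrite /musearch iteriS -/(musearch s F) h.
Qed.

Lemma ev_sound s f v y : ev s f v = y.+1 -> eval f v y.
Proof.
elim/prf_ind_nested: f v y => [|||f gs IHf IHgs|f g IHf IHg|f IHf].
- by move=> v y [<-]; constructor.
- by case=> // x v y [<-]; constructor.
- by move=> i v y /=; case: ifP => // hi [<-]; constructor.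
- move=> v y /=; case: ifP => // hall /IHf; apply: evComp.
  elim: gs IHgs hall => [|g gs IH] /=; first by constructor.
  move=> [hg hgs] /andP[h1 h2]; constructor; last exact: IH.
  by apply: hg; rewrite prednK.
- case=> // n v y /=; elim: n y => [|n IH] y /=.
    by move=> /IHf; constructor.
  case: ifP => // /negbT h /IHg; apply: evRecS; apply: IH.
  by rewrite prednK // lt0n.
- move=> v y /=; have [_] := musearch_spec s (fun m => ev s f (m :: v)).
  case: musearch => [|[|n]] //= /(_ n erefl) [h1 h2] [<-].
  apply: evMu; first exact: IHf.
  move=> m /h2 h; exists (ev s f (m :: v)).-2; apply: IHf.
  by case: (ev s f (m :: v)) h => // -[].
Qed.

(** The conclusion covers all large [s], so that bounds obtained for subcomputations combine by a
    maximum. *)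
Lemma ev_complete f v y : eval f v y -> exists s0, forall s, s0 <= s -> ev s f v = y.+1.
Proof.
elim/prf_ind_nested: f v y => [|||f gs IHf IHgs|f g IHf IHg|f IHf].
- by move=> v y h; inversion h; exists 0.
- by move=> v y h; inversion h; exists 0.
- by move=> i v y h; inversion h; subst; exists 0 => s _ /=; rewrite H0.
- move=> v y h; inversion h as [| | |? ? ? ws ? hgs hf| | |]; subst.
  have [s1 h1] : exists s0, forall s, s0 <= s ->
      [seq ev s g v | g <- gs] = [seq w.+1 | w <- ws].
    elim: gs IHgs ws hgs {h hf} => [|g gs IH] /=.
      by move=> _ ws h; inversion h; exists 0.
    move=> [hg hgs] ws h; inversion h as [|? ? ? w ws' e1 e2]; subst.
    have [a ha] := hg _ _ e1; have [b hb] := IH hgs _ e2.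
    exists (maxn a b) => s; rewrite geq_max => /andP[hs1 hs2].
    by rewrite ha // hb.
  have [s2 h2] := IHf _ _ hf.
  exists (maxn s1 s2) => s; rewrite geq_max => /andP[hs1 hs2] /=.
  rewrite h1 // all_map (eq_all (a2 := predT)) // all_predT -map_comp.
  by rewrite (eq_map (g := id)) // map_id h2.
- case=> [|n v] y; first by move=> h; inversion h.
  elim: n y => [|n IH] y h; inversion h as [| | | |? ? ? ? h1|? ? ? ? r ? h1 h2|]; subst.
    by have [s0 h0] := IHf _ _ h1; exists s0.
  have [a ha] := IH _ h1; have [b hb] := IHg _ _ h2.
  exists (maxn a b) => s; rewrite geq_max => /andP[hs1 hs2].
  by have /= -> := ha _ hs1; rewrite /= hb.
- move=> v y h; inversion h as [| | | | | |? ? ? h1 h2]; subst.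
  have [a ha] := IHf _ _ h1.
  have [b hb] : exists b, forall s, b <= s -> forall m, m < y -> 1 < ev s f (m :: v).
    elim: y h2 {h h1 ha} => [|y IH] h2; first by exists 0.
    have [|b hb] := IH; first by move=> m hm; apply: h2; rewrite ltnW.
    have [k /IHf [c hc]] := h2 y (leqnn _).
    exists (maxn b c) => s; rewrite geq_max => /andP[hs1 hs2] m.
    by rewrite ltnS leq_eqVlt => /orP[/eqP ->|hm]; [rewrite hc|exact: hb].
  exists (maxn (maxn a b) y.+1) => s; rewrite !geq_max => /andP[/andP[hs1 hs2] hs3] /=.
  by rewrite (musearch_complete (n := y)) //; [exact: ha|exact: hb].
Qed.

Lemma eval_functional f v y z : eval f v y -> eval f v z -> y = z.
Proof.
move=> /ev_complete[a ha] /ev_complete[b hb].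
by have [] : y.+1 = z.+1 by rewrite -(ha (maxn a b)) ?leq_maxl// hb ?leq_maxr.
Qed.

(** As [f] is fixed, the recursion on it takes place outside the computation; only the fuel and the
    arguments are inputs. The type [X] varies in the induction, since loops enlarge the context. *)
Lemma c_ev f X {EX : Enc X} (s : X -> nat) (v : X -> seq nat) :
  computable s -> computable v -> computable (fun x => ev (s x) f (v x)).
Proof.
elim/prf_ind_nested: f X EX s v => [||i|f gs IHf IHgs|f g IHf IHg|f IHf] X EX s v hs hv /=.
- by ccomp.
- apply: (@c_seqcase _ _ _ _ _ _ 0 v (fun _ => 0) (fun _ x _ => x.+2)) => //; ccomp.
- apply: c_if; ccomp; first by apply: (c_size 0).
  by apply: c_nth; ccomp.
- have h : computable (fun x => [seq ev (s x) g (v x) | g <- gs]).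
    elim: gs IHgs => [|g gs IH] /=; first by move=> _; ccomp.
    by move=> [hg hgs]; apply: c_cons; [exact: hg|exact: IH].
  apply: c_if; [apply: (c_all 0); ccomp| |ccomp].
  by apply: IHf => //; apply: (c_map 0) => //; ccomp.
- apply: (@c_seqcase _ _ _ _ _ _ 0 v (fun _ => 0) (fun x n v' =>
    iteri n (fun m r => if r == 0 then 0 else ev (s x) g [:: m, r.-1 & v']) (ev (s x) f v')))
    => //; ccomp.
  apply: c_iteri; ccomp.
    by apply: IHf; ccomp.
  by apply: IHg; ccomp.
- apply: c_pred; rewrite /musearch; apply: c_iteri; ccomp.
    by apply: IHf; ccomp.
  by apply: IHf; ccomp.
Qed.

End Evaluation.

(** * From decidable approximations to enumerating programs *)

Section Enumeration.
Local Open Scope nat_scope.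

(* [enum_approx f s c n]: on the input coded by [c], the machine [f] is seen to
   enumerate [n] within [s] steps. *)
Definition enum_approx f s c n :=
  (n < s) && has (fun t => ev s f [:: c; t] == n.+1) (iota 0 s).

Lemma enum_approx_sound f s c n : enum_approx f s c n -> exists t, eval f [:: c; t] n.
Proof. by move=> /andP[_ /hasP[t _ /eqP /ev_sound h]]; exists t. Qed.

Lemma enum_approx_complete f c n t : eval f [:: c; t] n ->
  exists s0, forall s, s0 <= s -> enum_approx f s c n.
Proof.
move=> /ev_complete[a ha]; exists (maxn a (maxn n t).+1) => s.
rewrite geq_max => /andP[h1 h2]; apply/andP; split; first by move: h2; lia.
by apply/hasP; exists t; [rewrite mem_iota; move: h2; lia|rewrite ha].
Qed.

Lemma c_enum_approx f X {EX : Enc X} (s c n : X -> nat) :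
  computable s -> computable c -> computable n ->
  computable (fun x => enum_approx f (s x) (c x) (n x)).
Proof.
move=> hs hc hn; apply: c_andb; ccomp; apply: (c_has 0); ccomp.
by apply: c_ev; ccomp.
Qed.

(** The program reads [z] as a pair of a time [t] and a value [n], and searches for an [m] such that
    [m = n] and [P c t n]. The search returns [n] if the test succeeds and diverges otherwise. *)
Lemma enumerator_of (P : nat -> nat -> nat -> bool) :
  computable (fun x : nat * (nat * nat) => P x.1 x.2.1 x.2.2) ->
  exists M, forall c n, (exists z, eval M [:: c; z] n) <-> (exists t, P c t n).
Proof.
move=> hP.
have [p hp] : computable (fun x : nat * (nat * nat) => nat_of_bool (~~
    (P x.2.1 (cfst x.2.2) (csnd x.2.2) && (csnd x.2.2 == x.1)))).
  have h : computable (fun x : nat * (nat * nat) => (x.2.1, (cfst x.2.2, csnd x.2.2))).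
    by clear hP; ccomp.
  have {}hP := c_comp hP h; clear h.
  apply: c_nat_of_bool; apply: c_negb; apply: c_andb; first exact: hP.
  by clear hP; ccomp.
pose F := PComp p [:: PComp ppair [:: PProj 0; PComp ppair [:: PProj 1; PProj 2]]].
have hF m c z : eval F [:: m; c; z] (~~ (P c (cfst z) (csnd z) && (csnd z == m))).
  apply: eval_comp1 (hp (m, (c, z))).
  apply: eval_comp2; [exact: eval_proj| |exact: eval_ppair].
  by apply: eval_comp2; [exact: eval_proj|exact: eval_proj|exact: eval_ppair].
exists (PMu F) => c n; split=> [[z h]|[t h]].
  inversion h as [| | | | | |? ? ? h1 _]; subst.
  have := eval_functional h1 (hF _ _ _).
  by case e : (_ && _) => // _; case/andP: e => + /eqP <-; exists (cfst z).
exists (cpair t n); apply: evMu => [|m hm].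
  by have := hF n c (cpair t n); rewrite cpairK1 cpairK2 h eqxx.
exists 0; have := hF m c (cpair t n); rewrite cpairK1 cpairK2.
by rewrite gtn_eqF // andbF.
Qed.

End Enumeration.

(** * Binary strings and their codes *)

Section Strings.
Local Open Scope nat_scope.

(** One step of decoding: the lowest binary digit goes to the front of the list, until only the
    leading digit 1 is left. Further steps change nothing, so [c] steps suffice for the code [c]. *)
Definition dstep (z : nat * seq bool) :=
  if z.1 <= 1 then z else (z.1./2, odd z.1 :: z.2).

Definition uncode c : seq bool := rev (iter c dstep (c, [::])).2.

Lemma code_gt0 x : 0 < code x.
Proof. by elim: x => //= b s; lia. Qed.

Lemma size_code x : size x < code x.
Proof. by elim: x => //= b s; lia. Qed.

Lemma bits_codeK : cancel code uncode.
Proof.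
move=> x; rewrite /uncode.
have h : forall n s t, size s <= n -> iter n dstep (code s, t) = (1, rev s ++ t).
  elim=> [|n IH] [|b s] t //= hn; rewrite -iterS iterSr /dstep /=.
    exact: (IH [::]).
  have := code_gt0 s => h0; rewrite leqNgt (_ : 1 < _) /=; last by lia.
  have -> : ((code s).*2 + b)./2 = code s by case: b; lia.
  have -> : odd ((code s).*2 + b) = b by case: b; lia.
  by rewrite IH // rev_cons cat_rcons.
by rewrite h ?cats0 ?revK // ltnW // size_code.
Qed.

Lemma bits_code_inj : injective code.
Proof. exact: can_inj bits_codeK. Qed.

Lemma c_uncode X {EX : Enc X} (c : X -> nat) :
  computable c -> computable (fun x => uncode (c x)).
Proof.
move=> hc; rewrite /uncode; apply: (c_rev false); apply: c_snd.
apply: c_iter; [exact: hc|by ccomp|].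
by rewrite /dstep; apply: c_if; ccomp.
Qed.

Lemma c_code X {EX : Enc X} (s : X -> seq bool) :
  computable s -> computable (fun x => code (s x)).
Proof.
move=> hs.
apply: (@c_eqfun _ _ _ _ (fun x => foldr (fun (b : bool) n => n + n + nat_of_bool b) 1 (s x))).
  by move=> x; elim: (s x) => //= b t ->; rewrite addnn.
by apply: (c_foldr false); ccomp.
Qed.

Fixpoint strs n : seq (seq bool) :=
  if n is m.+1 then map (cons true) (strs m) ++ map (cons false) (strs m)
  else [:: [::]].

Lemma mem_strs n s : (s \in strs n) = (size s == n).
Proof.
elim: n s => [|n IH] [|b s] //=; rewrite mem_cat.
  by apply/negP=> /orP[] /mapP[].
have hm c : ((b :: s) \in map (cons c) (strs n)) = (b == c) && (size s == n).
  apply/mapP/andP => [[u hu [-> ->]]|[/eqP -> h]]; first by rewrite eqxx -IH.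
  by exists s; rewrite ?IH.
by rewrite !hm eqSS; case: (b); rewrite ?orbF.
Qed.

Lemma c_strs X {EX : Enc X} (n : X -> nat) :
  computable n -> computable (fun x => strs (n x)).
Proof.
move=> hn; apply: (@c_eqfun _ _ _ _ (fun x => iter (n x)
  (fun u => map (cons true) u ++ map (cons false) u) [:: [::]])).
  by move=> x; elim: (n x) => //= k ->.
apply: c_iter; ccomp.
by apply: (c_cat [::]); apply: (c_map [::]); ccomp.
Qed.

End Strings.

#[local] Transparent computable cfst csnd cpair.

(** * The measure of open sets of bit sequences *)

Section Counting.
Local Open Scope nat_scope.
Implicit Types P Q : pred (seq bool).

Definition cnt n P := count P (strs n).

Lemma cntS n P :
  cnt n.+1 P = cnt n (fun s => P (true :: s)) + cnt n (fun s => P (false :: s)).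
Proof. by rewrite /cnt /= count_cat !count_map. Qed.

Lemma eq_cnt n P Q : (forall s, size s = n -> P s = Q s) -> cnt n P = cnt n Q.
Proof. by move=> h; apply: eq_in_count => s; rewrite mem_strs => /eqP; exact: h. Qed.

Lemma cnt_rcons n P :
  cnt n.+1 P = cnt n (fun s => P (rcons s true)) + cnt n (fun s => P (rcons s false)).
Proof.
elim: n P => [|n IH] P; first by rewrite /cnt /= !addn0.
rewrite [LHS]cntS (IH (fun s => P (true :: s))) (IH (fun s => P (false :: s))).
by rewrite addnACA (cntS n (fun s => P (rcons s true))) (cntS n (fun s => P (rcons s false))).
Qed.

Lemma cnt_predT n : cnt n predT = 2 ^ n.
Proof. by elim: n => // n IH; rewrite cntS !IH expnS mul2n addnn. Qed.

Lemma size_strs n : size (strs n) = 2 ^ n.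
Proof. by rewrite -cnt_predT /cnt count_predT. Qed.

Lemma cnt_add n P Q P' : (forall s, size s = n -> P s = Q s + P' s :> nat) ->
  cnt n P = cnt n Q + cnt n P'.
Proof.
elim: n P Q P' => [|n IH] P Q P' h; first by rewrite /cnt /= h // !addn0.
by rewrite !cntS addnACA; congr (_ + _); apply: IH => s hs; apply: h; rewrite /= hs.
Qed.

Lemma leq_cnt n P Q : (forall s, size s = n -> P s -> Q s) -> cnt n P <= cnt n Q.
Proof.
move=> h; rewrite (@cnt_add n Q P (fun s => Q s && ~~ P s)) ?leq_addr // => s /h.
by case: (P s) => [->|_] //; rewrite andbT.
Qed.

Lemma cnt_union n P Q :
  cnt n (fun s => P s || Q s) + cnt n (fun s => P s && Q s) = cnt n P + cnt n Q.
Proof. exact: count_predUI. Qed.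

Lemma cnt_has n (I : Type) (r : seq I) (F : I -> pred (seq bool)) :
  cnt n (fun s => has (fun i => F i s) r) <= \sum_(i <- r) cnt n (F i).
Proof.
elim: r => [|i r IH]; first by rewrite big_nil /cnt /= count_pred0.
rewrite big_cons; apply: leq_trans (leq_add (leqnn _) IH).
by rewrite -cnt_union leq_addr.
Qed.

(** Independence of the first bits from the later ones, in counting form. *)
Lemma cnt_cylinder n c P : size c <= n ->
  cnt n (fun s => (take (size c) s == c) && P (drop (size c) s)) = cnt (n - size c) P.
Proof.
elim: c n P => [|b c IH] n P /=.
  by move=> _; rewrite subn0; apply: eq_cnt => s _; rewrite take0 drop0.
case: n => // n hn; rewrite subSS -(IH n P hn) cntS /=.
have z b' : b' != b ->
    cnt n (fun s => (b' :: take (size c) s == b :: c) && P (drop (size c) s)) = 0.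
  move=> hb; rewrite (eq_cnt (Q := pred0)) /cnt ?count_pred0 // => s _.
  by rewrite eqseq_cons (negbTE hb).
by case: b z => z; [rewrite (z false) // addn0|rewrite (z true) // add0n];
  apply: eq_cnt => s _; rewrite eqseq_cons eqxx.
Qed.

Lemma cnt_take n m P : n <= m -> cnt m (fun s => P (take n s)) = 2 ^ (m - n) * cnt n P.
Proof.
elim: m => [|m IH]; first by rewrite leqn0 => /eqP ->; rewrite mul1n; apply: eq_cnt => -[].
rewrite leq_eqVlt => /orP[/eqP ->|]; last rewrite ltnS => hn.
  by rewrite subnn mul1n; apply: eq_cnt => s hs; rewrite take_oversize ?hs.
have e b : cnt m (fun s => P (take n (rcons s b))) = cnt m (fun s => P (take n s)).
  by apply: eq_cnt => s hs; rewrite -cats1 takel_cat ?hs.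
by rewrite cnt_rcons !e IH // addnn -mul2n mulnA -expnS subSn.
Qed.

Lemma uniq_strs n : uniq (strs n).
Proof.
elim: n => //= n IH; rewrite cat_uniq !map_inj_uniq ?IH /=; try by move=> ? ? [].
by rewrite andbT; apply/hasPn => s /mapP[t _ ->]; apply/negP => /mapP[].
Qed.

Lemma code_bounds s : 2 ^ size s <= code s < 2 ^ (size s).+1.
Proof. by elim: s => //= b s; rewrite !expnS; lia. Qed.

(** By [code_bounds] the codes lie in this interval; they are distinct, and both sides have [2 ^ l]
    elements. *)
Lemma perm_code_strs l : perm_eq [seq code s | s <- strs l] (index_iota (2 ^ l) (2 ^ l.+1)).
Proof.
have hu : uniq [seq code s | s <- strs l] by rewrite (map_inj_uniq bits_code_inj) uniq_strs.
apply: uniq_perm => //; first exact: iota_uniq.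
apply: (uniq_min_size hu _ _).2.
  move=> _ /mapP[s + ->]; rewrite mem_strs => /eqP hs.
  by rewrite mem_index_iota -hs code_bounds.
by rewrite size_map size_strs size_iota expnS; lia.
Qed.

(** Listing strings by code runs through them by increasing length; this turns a family indexed by
    strings into a sequence of cylinders. *)
Lemma sum_uncode (V : nmodType) (F : seq bool -> V) n :
  (\sum_(1 <= j < 2 ^ n) F (uncode j) = \sum_(0 <= l < n) \sum_(s <- strs l) F s)%R.
Proof.
elim: n => [|n IH]; first by rewrite !big_geq.
rewrite big_nat_recr //= -IH (big_cat_nat (n := 2 ^ n)) ?expn_gt0 ?leq_pexp2l //=; congr (_ + _)%R.
rewrite -(perm_big _ (perm_code_strs n)) big_map.
by apply: eq_bigr => s _; rewrite bits_codeK.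
Qed.

End Counting.

Section OpenSets.
Context {R : realType}.
Implicit Types (P Q : pred (seq bool)) (A : set (nat -> bool)) (e : R).

Definition den n P : R := (cnt n P)%:R / 2 ^+ n.

(** Such a [Q] stands for the open set of sequences having a prefix in [Q]; the densities [den n Q]
    increase to its measure. *)
Definition ext_closed Q := forall s b, Q s -> Q (rcons s b).

(* [outer A e]: the set [A] has an open neighbourhood of measure at most [e]. *)
Definition outer A e := exists Q, [/\ ext_closed Q,
  forall w, A w -> exists n, Q (prefix w n) & forall n, den n Q <= e].

Lemma bitsS w n : prefix w n.+1 = rcons (prefix w n) (w n).
Proof. exact: mkseqS. Qed.

Lemma size_bits w n : size (prefix w n) = n.
Proof. exact: size_mkseq. Qed.

Lemma take_bits w m n : (m <= n)%N -> take m (prefix w n) = prefix w m.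
Proof.
elim: n => [|n IH]; first by rewrite leqn0 => /eqP ->.
rewrite leq_eqVlt => /orP[/eqP ->|hm]; first by rewrite take_oversize ?size_bits.
by rewrite bitsS -cats1 takel_cat ?size_bits // IH.
Qed.

Lemma ext_closed_prefix Q w m n : ext_closed Q -> (m <= n)%N ->
  Q (prefix w m) -> Q (prefix w n).
Proof.
move=> hQ /subnK <- h; elim: (n - m)%N => // k IH.
by rewrite addSn bitsS; exact: hQ.
Qed.

Lemma le_den n P Q : (forall s, size s = n -> P s -> Q s) -> den n P <= den n Q.
Proof. by move=> h; rewrite /den ler_wpM2r ?invr_ge0 ?exprn_ge0 // ler_nat leq_cnt. Qed.

Lemma eq_den n P Q : (forall s, size s = n -> P s = Q s) -> den n P = den n Q.
Proof. by move=> h; rewrite /den (eq_cnt h). Qed.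

Lemma den_ge0 n P : 0 <= den n P.
Proof. by rewrite divr_ge0 // exprn_ge0. Qed.

Lemma den_take n m P : (n <= m)%N -> den m (fun s => P (take n s)) = den n P.
Proof.
move=> hn; rewrite /den cnt_take // natrM natrX -{2}(subnK hn) exprD invfM.
by rewrite mulrCA !mulrA mulVf ?mul1r // expf_neq0.
Qed.

Lemma den_union n P Q :
  den n (fun s => P s || Q s) + den n (fun s => P s && Q s) = den n P + den n Q.
Proof. by rewrite -!mulrDl -!natrD cnt_union. Qed.

Lemma den_mono Q m n : ext_closed Q -> (m <= n)%N -> den m Q <= den n Q.
Proof.
move=> hQ hm; rewrite -(den_take Q hm); apply: le_den => s hs h.
have h1 : Q (take n s).
  rewrite -(subnK hm); elim: (n - m)%N => // i IH; rewrite addSn.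
  have [hi|hi] := ltnP (i + m) (size s).
    by rewrite (take_nth false hi); exact: hQ.
  by move: IH; rewrite !take_oversize // ltnW.
by move: h1; rewrite take_oversize ?hs.
Qed.

Lemma outer_clopen A l P : (forall w, A w -> P (prefix w l)) -> outer A (den l P).
Proof.
move=> h; exists (fun s => (l <= size s)%N && P (take l s)); split.
- move=> s b /andP[h1 h2]; rewrite size_rcons ltnW //=.
  by rewrite -cats1 takel_cat.
- by move=> w /h hw; exists l; rewrite size_bits leqnn take_oversize ?size_bits.
move=> n; have [hn|hn] := leqP l n.
  by rewrite -(den_take P hn); apply: le_den => s _ /andP[].
apply: le_trans (den_ge0 _ _).
rewrite /den (_ : cnt n _ = 0%N) ?mul0r // (eq_cnt (Q := pred0)) /cnt ?count_pred0 //.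
by move=> s hs; rewrite hs leqNgt hn.
Qed.

Lemma le_outer A B e : (forall w, A w -> B w) -> outer B e -> outer A e.
Proof. by move=> h [Q [h1 h2 h3]]; exists Q; split => // w /h /h2. Qed.

Lemma outer_le A e e' : e <= e' -> outer A e -> outer A e'.
Proof. by move=> he [Q [h1 h2 h3]]; exists Q; split => // n; exact: le_trans (h3 n) he. Qed.

Lemma outer_ge0 A e : outer A e -> 0 <= e.
Proof. by move=> [Q [_ _ h]]; exact: le_trans (den_ge0 0 Q) (h 0%N). Qed.

(* The sets being arbitrary, each is replaced by a neighbourhood [Qs t] of
   measure within [d / 2 ^ (t + 2)] of the infimum [a t]. Adding [Qs T.+1] to the
   union of the earlier ones costs little, as both contain the [T]-th set and so
   their intersection has measure at least [a T]. *)
Lemma outer_bigcup (A : nat -> set (nat -> bool)) e d : 0 < d ->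
  (forall t w, A t w -> A t.+1 w) -> (forall t, outer (A t) e) ->
  outer [set w | exists t, A t w] (e + d).
Proof.
move=> hd hA he; pose E t : set R := [set x | outer (A t) x].
have lbE t : has_lbound (E t) by exists 0 => x /outer_ge0.
have infE t : has_inf (E t) by split => //; exists e; exact: he.
pose a t := inf (E t).
have d_gt0 k : 0 < d / 2 ^+ k by rewrite divr_gt0 // exprn_gt0.
have hQ t : exists Q, [/\ ext_closed Q,
    forall w, A t w -> exists n, Q (prefix w n) & forall n, den n Q <= a t + d / 2 ^+ t.+2].
  have [x [Q [h1 h2 h3]] hx] := inf_adherent (d_gt0 t.+2) (infE t).
  by exists Q; split => // n; apply: le_trans (h3 n) (ltW hx).
pose Qs t := projT1 (cid (hQ t)).
have Qe t : ext_closed (Qs t) by rewrite /Qs; case: cid => Q [].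
have QA t w : A t w -> exists n, Qs t (prefix w n).
  by rewrite /Qs; case: cid => Q [_ h _] /=; exact: h.
have Qd t n : den n (Qs t) <= a t + d / 2 ^+ t.+2.
  by rewrite /Qs; case: cid => Q [_ _ h] /=; exact: h.
pose fix U T s {struct T} := if T is T'.+1 then U T' s || Qs T s else Qs 0%N s.
have Ue T : ext_closed (U T).
  elim: T => [|T IH] s b //=; first exact: Qe.
  by move=> /orP[/IH ->|/Qe ->] //; rewrite orbT.
have UQ t T s : (t <= T)%N -> Qs t s -> U T s.
  elim: T => [|T IH]; first by rewrite leqn0 => /eqP ->.
  by rewrite leq_eqVlt => /orP[/eqP ->|/IH h] /=; [move=> ->; rewrite orbT|move=> /h ->].
(* Stage [T.+1] costs an error [d / 2 ^ T.+3] for [Qs T.+1] and the same again for the intersection,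
   together the [d / 2 ^ T.+2] by which the error term grows. *)
have Ud T n : den n (U T) <= a T + (d - d / 2 ^+ T.+1).
  elim: T n => [|T IH] n.
    apply: le_trans (Qd 0%N n) _; rewrite lerD2l expr2 expr1.
    by have := hd; lra.
  (* Otherwise the intersection would be a neighbourhood of [A T] with measure below the infimum
     [a T]. *)
  have [m hm] : exists m, a T - d / 2 ^+ T.+3 < den m (fun s => U T s && Qs T.+1 s).
    apply: contrapT => /forallNP h.
    have : outer (A T) (a T - d / 2 ^+ T.+3).
      exists (fun s => U T s && Qs T.+1 s); split.
      - by move=> s b /andP[/Ue -> /Qe ->].
      - move=> w hw; have [i hi] := QA _ _ hw; have [j hj] := QA _ _ (hA _ _ hw).
        exists (maxn i j); apply/andP; split.
          exact: ext_closed_prefix (Ue T) (leq_maxl i j) (UQ _ _ _ (leqnn T) hi).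
        exact: ext_closed_prefix (Qe _) (leq_maxr i j) hj.
      by move=> m; rewrite leNgt; apply/negP; exact: h.
    move=> /(ge_inf (lbE T)); rewrite -/(a T).
    by have := d_gt0 T.+3; lra.
  have hmn : den m (fun s => U T s && Qs T.+1 s) <= den (maxn m n) (fun s => U T s && Qs T.+1 s).
    by apply: den_mono (leq_maxl m n) => s b /andP[/Ue -> /Qe ->].
  apply: le_trans (den_mono (Ue T.+1) (leq_maxr m n)) _.
  have h1 := den_union (maxn m n) (U T) (Qs T.+1).
  have h2 := IH (maxn m n); have h3 := Qd T.+1 (maxn m n).
  have h4 : d / 2 ^+ T.+1 = 4 * (d / 2 ^+ T.+3) by rewrite !exprS; field.
  have h5 : d / 2 ^+ T.+2 = 2 * (d / 2 ^+ T.+3) by rewrite !exprS; field.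
  rewrite h4 in h2; rewrite h5; move: h1 h2 h3 hm hmn => /=; lra.
exists (fun s => `[< exists t, Qs t s >]); split.
- by move=> s b /asboolP[t /Qe h]; apply/asboolP; exists t.
- by move=> w [t /QA [n h]]; exists n; apply/asboolP; exists t.
(* There are finitely many strings of length [n], so at this length the full union is already
   reached by some [U T]. *)
move=> n; have [T hT] : exists T, forall s, size s = n -> `[< exists t, Qs t s >] -> U T s.
  have [T hT] : exists T, forall s, s \in strs n -> `[< exists t, Qs t s >] -> U T s.
    elim: (strs n) => [|s l [T IH]]; first by exists 0%N.
    have [t ht] : exists t, `[< exists t, Qs t s >] -> Qs t s.
      by case: (pselect (exists t, Qs t s)) => [[t h]|h]; [exists t|exists 0%N => /asboolP].
    have Um i j u : (i <= j)%N -> U i u -> U j u.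
      move=> /subnK <-; elim: (j - i)%N => // k IHk /IHk hk.
      by rewrite addSn /= hk.
    exists (maxn t T) => u; rewrite inE => /orP[/eqP ->|hu].
      by move=> /ht; apply: UQ; exact: leq_maxl.
    by move=> /(IH _ hu); apply: Um; exact: leq_maxr.
  by exists T => s hs; apply: hT; rewrite mem_strs hs.
apply: le_trans (le_den hT) _; apply: le_trans (Ud T n) _.
have h1 : a T <= e by apply: (ge_inf (lbE T)); exact: he.
by have := d_gt0 T.+1; lra.
Qed.

End OpenSets.

(** * Comparison with the outer measure of Cantor space *)

Section CantorMeasure.
Context {R : realType}.
Implicit Types (P Q : pred (seq bool)) (A : set (nat -> bool)) (e : R).

(** For [ext_closed] [Q] these are its minimal strings; their cylinders partition the open set. *)
Definition fresh Q s := Q s && ((s == [::]) || ~~ Q (take (size s).-1 s)).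

(** The sum telescopes: a string of length [n.+1] in [Q] either has its first [n] bits in [Q] or is
    fresh, and not both. *)
Lemma den_fresh Q n : ext_closed Q ->
  \sum_(0 <= l < n.+1) \sum_(s <- strs l) (if fresh Q s then 2 ^- size s else 0)
  = den n Q :> R.
Proof.
move=> hQ; have h l : \sum_(s <- strs l) (if fresh Q s then 2 ^- size s else 0)
    = den l (fresh Q) :> R.
  rewrite /den /cnt -sum1_count natr_sum mulr_suml -big_mkcond /= big_seq_cond.
  rewrite [RHS]big_seq_cond; apply: eq_bigr => s /andP[].
  by rewrite mem_strs => /eqP -> _; rewrite mul1r.
elim: n => [|n IH]; first rewrite big_nat1 h.
  by apply: eq_den => -[|//] _; rewrite /fresh eqxx andbT.
rewrite big_nat_recr // h IH /= -(den_take Q (leqnSn n)) /den -mulrDl -natrD; congr (_%:R / _).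
apply/esym; apply: cnt_add => s hs; rewrite /fresh hs /=.
case: s hs => // b s [hs].
have : Q (take n (b :: s)) -> Q (b :: s).
  by rewrite (lastI b s) -[n]hs -(size_belast b s) -cats1 take_size_cat // cats1; exact: hQ.
by case: (Q (take n _)) => [->|_]; rewrite ?andbF ?andbT ?add0n.
Qed.

Lemma sum_half n : \sum_(0 <= j < n) 2 ^- j.+1 = 1 - 2 ^- n :> R.
Proof.
elim: n => [|n IH]; first by rewrite big_geq // expr0 invr1 subrr.
by rewrite big_nat_recr //= IH exprS; field; rewrite expf_neq0.
Qed.

Lemma cantor_measure_le A e : outer A e -> (cantor_measure R A <= e%:E)%E.
Proof.
move=> [Q [hQ hA hd]]; apply/lee_addgt0Pr => d d_gt0.
pose J := Num.bound d^-1; have hJ : 2 ^- J <= d.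
  have := upper_nthrootP (x := d^-1) (leqnn J) => h.
  by rewrite -[d]invrK lef_pV2 ?posrE ?invr_gt0 ?exprn_gt0 // ltW.
(* A cover must be indexed by all of [nat]: an index whose string is not fresh receives a string of
   length [j.+1 + J], and these padding cylinders weigh at most [2 ^- J <= d] in total. The shift by
   one is due to codes being positive. *)
pose c j := let s := uncode j.+1 in if fresh Q s then s else nseq (j.+1 + J) false.
apply: ereal_inf_le; exists (\sum_(0 <= i <oo) (2 ^- size (c i))%:E)%E.
  exists c => // w /hA hw; have [n hn hmin] := ex_minnP hw.
  have hf : fresh Q (prefix w n).
    rewrite /fresh hn size_bits; case: n hn hmin => //= n _ hmin.
    by rewrite take_bits //; apply/negP => h; have := hmin _ h; rewrite ltnn.
  exists (code (prefix w n)).-1 => //.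
  by rewrite /cylinder /= /c prednK ?code_gt0 // bits_codeK hf size_bits.
apply: lime_le; first by apply: is_cvg_nneseries => i _ _; rewrite lee_fin invr_ge0 exprn_ge0.
apply: nearW => n; rewrite sumEFin lee_fin.
pose F s : R := if fresh Q s then 2 ^- size s else 0.
have F_ge0 s : 0 <= F s by rewrite /F; case: ifP => // _; rewrite invr_ge0 exprn_ge0.
have hc i : 2 ^- size (c i) <= F (uncode i.+1) + 2 ^- J * 2 ^- i.+1.
  rewrite /c /F; case: ifP => _ /=; first by rewrite lerDl mulr_ge0 // invr_ge0 exprn_ge0.
  by rewrite size_nseq add0r -addSn exprD invfM mulrC.
apply: le_trans (ler_sum _ (fun i _ => hc i)) _.
rewrite big_split /= -mulr_sumr sum_half; apply: lerD.
  rewrite -(big_add1 _ _ 0 n.+1 xpredT (fun j => F (uncode j))).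
  apply: le_trans (hd n); rewrite -(den_fresh n hQ) -sum_uncode.
  rewrite (big_cat_nat (n := n.+1) (p := (2 ^ n.+1)%N)) //=; last by rewrite ltnW // ltn_expl.
  by rewrite lerDl sumr_ge0 // => j _; exact: F_ge0.
by apply: le_trans hJ; rewrite ler_piMr ?invr_ge0 ?exprn_ge0 // gerBl.
Qed.

Lemma cantor_measure_le1 A : (cantor_measure R A <= 1%:E)%E.
Proof.
apply: cantor_measure_le; have -> : 1 = den 0 predT :> R by rewrite /den cnt_predT expr0 divr1.
exact: outer_clopen.
Qed.

Lemma cantor_measure_ge0 A : (0 <= cantor_measure R A)%E.
Proof.
apply: le_ereal_inf_tmp => _ [c _ <-]; apply: nneseries_ge0 => i _ _.
by rewrite lee_fin invr_ge0 exprn_ge0.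
Qed.

Lemma cantor_measure_fin A : cantor_measure R A = (fine (cantor_measure R A))%:E.
Proof.
rewrite fineK // ge0_fin_numE ?cantor_measure_ge0 //.
exact: le_lt_trans (cantor_measure_le1 A) (ltry _).
Qed.

(* Compactness: were no finite part of the cover enough, one could choose bits one
   after the other so that it never becomes enough, and the resulting sequence would
   not be covered. *)
Lemma clopen_cover l P (c : nat -> seq bool) :
  (forall w, P (prefix w l) -> exists i, cylinder (c i) w) ->
  exists n, (l <= n)%N /\ forall t, size t = n -> P (take l t) ->
    has (fun i => take (size (c i)) t == c i) (iota 0 n).
Proof.
move=> hc.
(* Finitely many of the [c i] suffice for the part of the clopen set inside the cylinder of [s], as
   seen on strings of one length [n]. *)
pose FC s := exists n, (maxn l (size s) <= n)%N /\
  forall t, size t = n -> take (size s) t = s -> P (take l t) ->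
    has (fun i => take (size (c i)) t == c i) (iota 0 n).
apply: contrapT => hnot.
have FC0 : ~ FC [::].
  move=> [n [hn h]]; apply: hnot; exists n; rewrite geq_max in hn.
  case/andP: hn => hn _; split=> // t ht.
  by apply: h => //; rewrite take0.
have FCS s : FC (rcons s true) -> FC (rcons s false) -> FC s.
  move=> [m [hm h1]] [n [hn h2]].
  have hmn N b : (maxn l (size (rcons s b)) <= N)%N ->
      (forall t, size t = N -> take (size (rcons s b)) t = rcons s b -> P (take l t) ->
        has (fun i => take (size (c i)) t == c i) (iota 0 N)) ->
      forall t, (N <= size t)%N -> take (size (rcons s b)) t = rcons s b -> P (take l t) ->
        has (fun i => take (size (c i)) t == c i) (iota 0 (size t)).
    rewrite geq_max => /andP[hl hs] h t ht e p.
    have := h (take N t); rewrite size_takel // !take_takel // => /(_ erefl e p).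
    move=> /hasP[i]; rewrite mem_iota add0n => /= hi /eqP hit.
    apply/hasP; exists i; first by rewrite mem_iota add0n /= (leq_trans hi).
    have hsi : (size (c i) <= N)%N.
      by rewrite -hit size_take_min (leq_trans (geq_minr _ _)) // size_takel.
    by rewrite -[X in _ == X]hit take_takel // eqxx.
  exists (maxn m n); split.
    move: hm hn; rewrite !size_rcons; lia.
  move=> t ht e p; have hlt : (size s < size t)%N by move: hm; rewrite ht size_rcons; lia.
  have e' : take (size (rcons s (nth false t (size s)))) t = rcons s (nth false t (size s)).
    by rewrite size_rcons (take_nth false hlt) e.
  rewrite -ht; case: (nth _ _ _) e' => e'.
    by apply: (hmn m true) => //; rewrite ht leq_maxl.
  by apply: (hmn n false) => //; rewrite ht leq_maxr.
pose b s := ~~ `[< FC (rcons s true) >].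
have bP s : ~ FC s -> ~ FC (rcons s (b s)).
  rewrite /b; case: asboolP => h hs //= h'; exact: hs (FCS _ h h').
pose p n := iter n (fun s => rcons s (b s)) [::].
pose w n := b (p n).
have pw n : prefix w n = p n by elim: n => // n IH; rewrite bitsS IH.
have pFC n : ~ FC (prefix w n).
  by rewrite pw; elim: n => [|n IH]; [exact: FC0|exact: bP].
case: (boolP (P (prefix w l))) => hP.
  have [i hi] := hc w hP; pose n := maxn l (maxn i.+1 (size (c i))).
  apply: (pFC n); exists n; rewrite size_bits; split; first by rewrite geq_max leq_maxl leqnn.
  move=> t ht; rewrite take_oversize ?ht // => -> _; apply/hasP; exists i.
    by rewrite mem_iota add0n /= /n; lia.
  by rewrite take_bits ?hi // /n; lia.
apply: (pFC l); exists l; rewrite size_bits maxnn; split => // t ht.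
by rewrite take_oversize ?ht // => ->; rewrite (negbTE hP).
Qed.

Lemma den_cylinder n c : den n (fun t => take (size c) t == c) <= 2 ^- size c :> R.
Proof.
have [hc|hc] := leqP (size c) n; last first.
  rewrite (eq_den (Q := pred0)) => [|t ht].
    by rewrite /den /cnt count_pred0 mul0r invr_ge0 exprn_ge0.
  apply/negP => /eqP /(congr1 size); rewrite size_take_min ht (minn_idPr (ltnW hc)).
  by move=> h; rewrite -h ltnn in hc.
rewrite (eq_den (Q := fun t => (take (size c) t == c) && predT (drop (size c) t))) => [|t _].
  rewrite /den cnt_cylinder // cnt_predT natrX -{2}(subnK hc) exprD invfM mulrA.
  by rewrite divff ?mul1r // expf_neq0.
by rewrite andbT.
Qed.

Lemma den_has n (r : seq nat) (F : nat -> pred (seq bool)) :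
  den n (fun s => has (fun i => F i s) r) <= \sum_(i <- r) den n (F i) :> R.
Proof.
by rewrite /den -mulr_suml -natr_sum ler_wpM2r ?invr_ge0 ?exprn_ge0 // ler_nat cnt_has.
Qed.

(** By compactness finitely many cylinders of a cover of [A] already cover the clopen set, and for
    these the union bound is a count of strings of a common length. *)
Lemma cantor_measure_ge A l P : (forall w, P (prefix w l) -> A w) ->
  ((den l P)%:E <= cantor_measure R A)%E.
Proof.
move=> hPA; apply: le_ereal_inf_tmp => _ [c hA <-].
have [|n [hln hn]] := @clopen_cover l P c.
  by move=> w /hPA /hA [i _ hi]; exists i.
have h : (\sum_(0 <= i < n) (2 ^- size (c i))%:E <=
    \sum_(0 <= i <oo) (2 ^- size (c i))%:E :> \bar R)%E.
  by apply: nneseries_lim_ge => i _ _; rewrite lee_fin invr_ge0 exprn_ge0.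
apply: le_trans h.
rewrite sumEFin lee_fin -(den_take P hln); apply: le_trans (le_den hn) _.
apply: le_trans (den_has _ _ _) _; rewrite /index_iota subn0.
by apply: ler_sum => i _; exact: den_cylinder.
Qed.

End CantorMeasure.

(** * The adaptive machine *)

Section Trace.
Local Open Scope nat_scope.
Variables D0 M0 : prf.
Implicit Types (r n t k L e : nat) (w : nat -> bool) (h u T : seq nat).

(** Only prefixes of length at most [r] are inspected, so the first [r] bits of [w] determine the
    result. *)
Definition xset r n w :=
  [seq j <- iota 0 n | has (fun i => enum_approx M0 r (code (prefix w i)) j) (iota 0 r.+1)].

Definition bits s : nat -> bool := nth false s.

(* A move [e] stands for a triple of numbers: a time, a level, and the code of a
   string of bits for which the machine [M0], observed at that time below that
   level, enumerates the set [goal e]. *)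
Definition time e := cfst e.
Definition level e := cfst (csnd e).
Definition goal e := xset (time e) (level e) (bits (uncode (csnd (csnd e)))).

Definition strict_sub T u := all (mem u) T && has (fun x => x \notin T) u.

Definition joins e w T := (xset (time e) (level e) w == goal e) && strict_sub T (goal e).

(** A history lists the latest move first, so the right fold replays the moves in chronological
    order. *)
Definition output h w := foldr (fun e T => if joins e w T then goal e else T) [::] h.

Definition group h e w := joins e w (output h w).

(** This is a lower bound [2 ^- k] for the measure of the group, cleared of denominators. Strings of
    length [t] decide membership once [e] and all moves of [h] are below [t]. *)
Definition admissible k t h e := 2 ^ t <= 2 ^ k * cnt t (fun s => group h e (bits s)).

Definition yset t p := [seq j <- iota 0 t | enum_approx D0 t (code p) j].

Definition covered L t u :=
  has (fun l => has (fun p => yset t p == u) (strs l)) (iota 0 L.+1).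

Definition ready L t h := if h is e :: _ then covered L t (goal e) else true.

(** The least admissible move is taken; this priority is the source of fairness. *)
Definition extend k t h :=
  if [seq e <- iota 0 t | admissible k t h e] is e :: _ then e :: h else h.

Definition trace k L t :=
  iteri t (fun t h => if ready L t h then extend k t h else h) [::].

Lemma mem_xset r n w j : j \in xset r n w ->
  [/\ j < n, j < r & penumerates M0 w j].
Proof.
rewrite mem_filter mem_iota add0n => /andP[/hasP[i _ h] /= hj]; split=> //.
  by case/andP: h.
by have [t ht] := enum_approx_sound h; exists i, t.
Qed.

Lemma xset_complete w j : penumerates M0 w j ->
  exists s, forall r n, s <= r -> j < n -> j \in xset r n w.
Proof.
move=> [i [t /enum_approx_complete[s hs]]]; exists (maxn s i) => r n.
rewrite geq_max => /andP[h1 h2] hj; rewrite mem_filter mem_iota add0n leq0n hj !andbT.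
by apply/hasP; exists i; [rewrite mem_iota add0n ltnS|exact: hs].
Qed.

Lemma uniq_xset r n w : uniq (xset r n w).
Proof. by rewrite filter_uniq // iota_uniq. Qed.

Lemma eq_prefix w w' i : (forall j, j < i -> w j = w' j) -> prefix w i = prefix w' i.
Proof. by move=> h; apply/eq_in_map => j; rewrite mem_iota add0n => /h. Qed.

Lemma eq_xset r n w w' : (forall i, i < r -> w i = w' i) -> xset r n w = xset r n w'.
Proof.
move=> h; apply: eq_filter => j; apply: eq_in_has => i; rewrite mem_iota add0n ltnS => /= hi.
by rewrite (@eq_prefix w w') // => a ha; apply: h; exact: leq_trans ha hi.
Qed.

Lemma bits_prefix w n i : i < n -> bits (prefix w n) i = w i.
Proof. exact: nth_mkseq. Qed.

(** A move [e] consults only bits below [time e], and [time e <= e < t]. *)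
Lemma eq_output h t w w' : {in h, forall e, e < t} -> (forall i, i < t -> w i = w' i) ->
  output h w = output h w'.
Proof.
move=> + hw; elim: h => //= e h IH he.
rewrite IH /joins; last by move=> a ha; apply: he; rewrite inE ha orbT.
rewrite (@eq_xset _ _ w w') // => i hi; apply: hw.
have : e < t by apply: he; rewrite inE eqxx.
by have := leq_cfst e; rewrite /time in hi; lia.
Qed.

Lemma eq_group h e t w w' : {in e :: h, forall a, a < t} -> (forall i, i < t -> w i = w' i) ->
  group h e w = group h e w'.
Proof.
move=> he hw; rewrite /group (@eq_output h t w w') //; last first.
  by move=> a ha; apply: he; rewrite inE ha orbT.
rewrite /joins (@eq_xset _ _ w w') // => i hi; apply: hw.
have : e < t by apply: he; rewrite inE eqxx.
by have := leq_cfst e; rewrite /time in hi; lia.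
Qed.

Lemma strict_sub_irrefl u : strict_sub u u = false.
Proof.
by apply/negP => /andP[_ /hasP[x hx]]; rewrite hx.
Qed.

Lemma strict_sub_trans T T' u : {subset T <= T'} -> strict_sub T' u -> strict_sub T u.
Proof.
move=> hT /andP[/allP h1 /hasP[x h2 h3]]; apply/andP; split.
  by apply/allP => y /hT /h1.
by apply/hasP; exists x => //; apply: contra h3 => /hT.
Qed.

Lemma output_cons h e w : {subset output h w <= output (e :: h) w}.
Proof.
by move=> j hj; rewrite /output /=; case: ifP => // /andP[_ /andP[/allP h1 _]]; exact: h1.
Qed.

Lemma mem_output h w j : j \in output h w -> penumerates M0 w j.
Proof.
elim: h => //= e h IH; case: ifP => // /andP[/eqP <- _] /mem_xset[] //.
Qed.

Lemma output_xset h w : output h w != [::] ->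
  exists2 e, e \in h & output h w = xset (time e) (level e) w /\ goal e = output h w.
Proof.
elim: h => //= e h IH; case: ifP => [/andP[/eqP he _] _|_ /IH[a ha hw]].
  by exists e; rewrite ?inE ?eqxx ?he.
by exists a => //; rewrite inE ha orbT.
Qed.

Lemma uniq_output h w : uniq (output h w).
Proof.
by case: (eqVneq (output h w) [::]) => [->//|/output_xset[e _ [-> _]]]; exact: uniq_xset.
Qed.

(** A sequence that joined [e] has contained [goal e] ever since. One that did not join failed a
    test that does not depend on the history, or had an output not strictly inside [goal e], and
    growth of the output cannot repair this. *)
Lemma group_mem h e w : e \in h -> group h e w = false.
Proof.
elim: h => //= a h IH; rewrite inE /group /= => /orP[/eqP <-|/IH].
  by case e1 : (joins e w (output h w)); rewrite ?e1 // /joins strict_sub_irrefl andbF.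
move=> h1; apply: contraFF h1 => /andP[h2 h3]; apply/andP; split=> //.
exact: strict_sub_trans (@output_cons h a w) h3.
Qed.

Lemma traceS k L t : trace k L t.+1 =
  if ready L t (trace k L t) then extend k t (trace k L t) else trace k L t.
Proof. by []. Qed.

Variant trace_spec k L t : seq nat -> Prop :=
| TraceStay : trace_spec k L t (trace k L t)
| TraceMove e : e < t -> ready L t (trace k L t) -> admissible k t (trace k L t) e ->
    trace_spec k L t (e :: trace k L t).

Lemma traceP k L t : trace_spec k L t (trace k L t.+1).
Proof.
rewrite traceS; case: ifP => [hr|_]; last exact: TraceStay.
rewrite /extend; case he : [seq _ <- _ | _] => [|e s]; first exact: TraceStay.
have : e \in [seq e <- iota 0 t | admissible k t (trace k L t) e] by rewrite he inE eqxx.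
by rewrite mem_filter mem_iota add0n => /andP[h1 h2]; exact: TraceMove.
Qed.

Lemma trace_lt k L t : {in trace k L t, forall e, e < t}.
Proof.
elim: t => // t IH e; case: traceP => [/IH|a ha _ _]; first exact: leqW.
by rewrite inE => /orP[/eqP ->|/IH]; exact: leqW.
Qed.

Lemma admissible_group k t h e : admissible k t h e ->
  exists2 s, size s = t & group h e (bits s).
Proof.
move=> ha; have : 0 < cnt t (fun s => group h e (bits s)).
  by move: ha; rewrite /admissible; case: (cnt _ _) => //; rewrite muln0 leqn0 expn_eq0.
by rewrite /cnt -has_count => /hasP[s]; rewrite mem_strs => /eqP hs; exists s.
Qed.

(** An admissible move has a nonempty group, while the group of a past move is empty. *)
Lemma uniq_trace k L t : uniq (trace k L t).
Proof.
elim: t => // t IH; case: traceP => // e _ _ /admissible_group[s _ hs] /=.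
by rewrite IH andbT; apply/negP => hm; rewrite (group_mem _ hm) in hs.
Qed.

Lemma trace_head k L t e h : trace k L t = e :: h ->
  exists t', [/\ t' < t, trace k L t' = h, e < t' & admissible k t' h e].
Proof.
elim: t => // t IH; case: traceP => [/IH[t' [h1 h2 h3 h4]]|a ha _ hb [<- <-]].
  by exists t'; split=> //; exact: leqW.
by exists t.
Qed.

Lemma output_trace k L t t' w : t <= t' ->
  {subset output (trace k L t) w <= output (trace k L t') w}.
Proof.
move=> /subnK <-; elim: (t' - t) => // n IH j /IH hj; rewrite addSn.
by case: traceP => [//|e _ _ _]; exact: output_cons.
Qed.

End Trace.

(** * The machine with its header, and its computability *)

Section Machine.
Local Open Scope nat_scope.
Variables D0 M0 : prf.

(* A bit sequence is read as [1^l 0 b y] with [size b = l]; [b] codes the pair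
   [(k, L)] and [y] supplies the random bits. *)
Definition lead (x : seq bool) := foldr (fun b n => if b then n.+1 else 0) 0 x.

Definition header (x : seq bool) := mkseq (fun i => nth false x ((lead x).+1 + i)) (lead x).

Definition body (x : seq bool) i := nth false x ((lead x + lead x).+1 + i).

(** Time [t] is simulated only if [x] supplies the [t] bits that the moves made by then can consult,
    so that different prefixes of one sequence never disagree. *)
Definition answers c t j :=
  let x := uncode c in
  let q := code (header x) in
  ((lead x + lead x).+1 + t <= size x) &&
  (j \in output M0 (trace D0 M0 (cfst q) (csnd q) t) (body x)).

Lemma c_xset X {EX : Enc X} (r n : X -> nat) (w : X -> nat -> bool) :
  computable r -> computable n -> computable (fun z : X * nat => w z.1 z.2) ->
  computable (fun x => xset M0 (r x) (n x) (w x)).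
Proof.
move=> hr hn hw; rewrite /xset; apply: (c_filter 0); first exact: c_iota.
apply: (c_has 0); first by apply: c_iota; apply: c_succ; apply: (c_comp hr); ccomp.
apply: c_enum_approx; first by apply: (c_comp hr); ccomp.
  apply: c_code; apply: c_mkseq; first by ccomp.
  apply: (c_comp hw (f := fun z : X * nat * nat * nat => (z.1.1.1, z.2))).
  by clear; ccomp.
by ccomp.
Qed.

Lemma c_goal X {EX : Enc X} (e : X -> nat) :
  computable e -> computable (fun x => goal M0 (e x)).
Proof.
move=> he; rewrite /goal /time /level /bits; apply: c_xset; try by ccomp.
by apply: c_nth; [apply: c_uncode; ccomp|ccomp].
Qed.

Lemma c_strict_sub X {EX : Enc X} (s u : X -> seq nat) :
  computable s -> computable u -> computable (fun x => strict_sub (s x) (u x)).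
Proof.
move=> hs hu; rewrite /strict_sub; apply: c_andb; first exact: c_subseq_mem.
by apply: (c_has 0) => //; apply: c_negb; apply: c_mem; ccomp.
Qed.

Lemma c_joins X {EX : Enc X} (e : X -> nat) (w : X -> nat -> bool) (u : X -> seq nat) :
  computable e -> computable u -> computable (fun z : X * nat => w z.1 z.2) ->
  computable (fun x => joins M0 (e x) (w x) (u x)).
Proof.
move=> he hu hw; rewrite /joins /time /level; apply: c_andb.
  by apply: c_eq; [apply: c_xset => //; ccomp|exact: c_goal].
by apply: c_strict_sub => //; exact: c_goal.
Qed.

Lemma c_output X {EX : Enc X} (h : X -> seq nat) (w : X -> nat -> bool) :
  computable h -> computable (fun z : X * nat => w z.1 z.2) ->
  computable (fun x => output M0 (h x) (w x)).
Proof.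
move=> hh hw; rewrite /output; apply: (c_foldr 0) => //; first exact: c_const.
apply: c_if; last by clear; ccomp.
  apply: c_joins; try by clear; ccomp.
  apply: (c_comp hw (f := fun z : X * (nat * seq nat) * nat => (z.1.1, z.2))).
  by clear; ccomp.
by apply: c_goal; clear; ccomp.
Qed.

Lemma c_admissible X {EX : Enc X} (k t e : X -> nat) (h : X -> seq nat) :
  computable k -> computable t -> computable h -> computable e ->
  computable (fun x => admissible M0 (k x) (t x) (h x) (e x)).
Proof.
move=> hk ht hh he; rewrite /admissible; apply: c_leq; first exact: c_expn2.
apply: c_muln; first exact: c_expn2.
rewrite /cnt; apply: (c_count [::]); first exact: c_strs.
rewrite /group /bits; apply: c_joins.
- by apply: (c_comp he); clear; ccomp.
- apply: c_output; first by apply: (c_comp hh); clear; ccomp.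
  by apply: c_nth; clear; ccomp.
- by apply: c_nth; clear; ccomp.
Qed.

Lemma c_covered X {EX : Enc X} (L t : X -> nat) (u : X -> seq nat) :
  computable L -> computable t -> computable u ->
  computable (fun x => covered D0 (L x) (t x) (u x)).
Proof.
move=> hL ht hu; rewrite /covered /yset; apply: (c_has 0).
  by apply: c_iota; exact: c_succ.
apply: (c_has [::]); first by apply: c_strs; clear; ccomp.
apply: c_eq; last by apply: (c_comp hu); clear; ccomp.
apply: (c_filter 0); first by apply: c_iota; apply: (c_comp ht); clear; ccomp.
apply: c_enum_approx; first by apply: (c_comp ht); clear; ccomp.
  by apply: c_code; clear; ccomp.
by clear; ccomp.
Qed.

Lemma c_trace X {EX : Enc X} (k L t : X -> nat) :
  computable k -> computable L -> computable t ->
  computable (fun x => trace D0 M0 (k x) (L x) (t x)).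
Proof.
move=> hk hL ht; rewrite /trace /ready /extend; apply: c_iteri => //; first exact: c_const.
have hk' : computable (fun z : X * (nat * seq nat) => k z.1).
  by apply: (c_comp hk); clear; ccomp.
have hL' : computable (fun z : X * (nat * seq nat) => L z.1).
  by apply: (c_comp hL); clear; ccomp.
apply: c_if; last by clear; ccomp.
  apply: (@c_seqcase _ _ _ _ _ _ 0 (fun z : X * (nat * seq nat) => z.2.2) (fun _ => true)
    (fun z e _ => covered D0 (L z.1) z.2.1 (goal M0 e))); try by clear; ccomp.
  apply: c_covered; last by apply: c_goal; clear; ccomp.
    by apply: (c_comp hL'); clear; ccomp.
  by clear; ccomp.
apply: (@c_seqcase _ _ _ _ _ _ 0 (fun z : X * (nat * seq nat) =>
    [seq e <- iota 0 z.2.1 | admissible M0 (k z.1) z.2.1 z.2.2 e])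
  (fun z => z.2.2) (fun z e _ => e :: z.2.2)); try by clear; ccomp.
apply: (c_filter 0); first by clear; ccomp.
apply: c_admissible; try by clear; ccomp.
by apply: (c_comp hk'); clear; ccomp.
Qed.

Lemma c_answers : computable (fun x : nat * (nat * nat) => answers x.1 x.2.1 x.2.2).
Proof.
have hu : computable (fun x : nat * (nat * nat) => uncode x.1).
  by apply: c_uncode; ccomp.
have hlead : forall X (EX : Enc X) (x : X -> seq bool), computable x ->
    computable (fun z => lead (x z)).
  by move=> X EX x hx; rewrite /lead; apply: (c_foldr false) => //; ccomp.
have hl := hlead _ _ _ hu.
have hq : computable (fun x : nat * (nat * nat) => code (header (uncode x.1))).
  apply: c_code; rewrite /header; apply: c_mkseq; first exact: hl.
  apply: c_nth; first by apply: c_uncode; clear; ccomp.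
  apply: c_addn; last by clear; ccomp.
  by apply: c_succ; apply: hlead; apply: c_uncode; clear; ccomp.
rewrite /answers; apply: c_andb.
  apply: c_leq; last by apply: (c_size false); exact: hu.
  by apply: c_addn; [apply: c_succ; exact: c_addn|clear; ccomp].
apply: c_mem; first by clear; ccomp.
apply: c_output.
  by apply: c_trace; [exact: c_cfst|exact: c_csnd|clear; ccomp].
rewrite /body; apply: c_nth; first by apply: c_uncode; clear; ccomp.
apply: c_addn; last by clear; ccomp.
apply: c_succ; apply: c_addn; apply: hlead; apply: c_uncode; clear; ccomp.
Qed.

End Machine.

(** * The set enumerated on a sequence with a given header *)

Section Simulation.
Local Open Scope nat_scope.
Variables (D0 M0 M : prf).
Hypothesis hM : forall c n, (exists z, eval M [:: c; z] n) <-> (exists t, answers D0 M0 c t n).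

Definition tag (b : seq bool) := nseq (size b) true ++ false :: b.

Lemma size_tag b : size (tag b) = (size b + size b).+1.
Proof. by rewrite size_cat size_nseq /= addnS. Qed.

Lemma lead_take n l y : lead (take n (nseq l true ++ false :: y)) = minn n l.
Proof.
by elim: l n => [|l IH] [|n] //=; rewrite IH minnSS.
Qed.

Definition tail n (w : nat -> bool) i := w (n + i).

(** Prefixes long enough for time [t] contain the whole tag and yield the output at that time;
    shorter ones are rejected by the length test. *)
Lemma penumerates_tag b w : prefix w (size (tag b)) = tag b ->
  penumerates M w = [set j | exists t, j \in
    output M0 (trace D0 M0 (cfst (code b)) (csnd (code b)) t) (tail (size (tag b)) w)].
Proof.
move=> hw.
have hlead n : lead (prefix w n) = minn n (size b).
  have := take_bits w (leq_maxl n (size (tag b))).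
  rewrite -(cat_take_drop (size (tag b)) (prefix w (maxn n _))) (take_bits _ (leq_maxr _ _)) hw.
  by move=> <-; rewrite /tag -catA /= lead_take.
have key n t j : (size (tag b)) + t <= n ->
    answers D0 M0 (code (prefix w n)) t j = (j \in
    output M0 (trace D0 M0 (cfst (code b)) (csnd (code b)) t) (tail (size (tag b)) w)).
  move=> hn; have hb : size b <= n by move: hn; rewrite size_tag; lia.
  rewrite /answers bits_codeK hlead (minn_idPr hb) size_bits -size_tag hn /=.
  have -> : header (prefix w n) = b.
    rewrite /header hlead (minn_idPr hb).
    apply: (@eq_from_nth _ false); first by rewrite size_mkseq.
    move=> i; rewrite size_mkseq => hi; rewrite nth_mkseq //.
    have hi' : (size b).+1 + i < size (tag b) by rewrite size_tag; lia.
    rewrite nth_mkseq; last by apply: leq_trans hn; apply: leq_trans hi' (leq_addr _ _).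
    have := congr1 (fun s => nth false s ((size b).+1 + i)) hw; rewrite nth_mkseq // => ->.
    rewrite /tag nth_cat size_nseq ifN; last by rewrite -leqNgt; lia.
    by rewrite (_ : _ - _ = i.+1) //; lia.
  congr (_ \in _); apply: eq_output; first exact: trace_lt.
  move=> i hi; rewrite /body hlead (minn_idPr hb) -size_tag /tail nth_mkseq //.
  by apply: leq_trans hn; rewrite ltn_add2l.
apply/seteqP; split=> j /=.
  move=> [n [z hz]]; have [t ht] : exists t, answers D0 M0 (code (prefix w n)) t j.
    by apply/hM; exists z.
  exists t; rewrite -(key n) // size_tag.
  (* On a prefix of length [n <= size b] only ones are read, [lead] equals [n], and the length test
     fails. *)
  move: ht => /andP[+ _]; rewrite bits_codeK size_bits hlead.
  by case: (leqP n (size b)); lia.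
move=> [t ht]; exists (size (tag b) + t); apply/hM; exists t.
by rewrite key.
Qed.

End Simulation.

Lemma infinite_pigeonhole (T : Type) (r : seq T) (Q : nat -> T -> bool) :
  (forall m : nat, exists2 t : nat, (m <= t)%N & has (Q t) r) ->
  exists p : T, List.In p r /\ forall m : nat, exists2 t : nat, (m <= t)%N & Q t p.
Proof.
elim: r => [|p r IH] h; first by have [t _] := h 0%N.
have [hp|] := pselect (forall m : nat, exists2 t : nat, (m <= t)%N & Q t p).
  by exists p; split => //; left.
move=> /existsNP[m0 hm0]; have [|q [hq1 hq2]] := IH; last by exists q; split => //; right.
move=> m; have [t ht /orP[hp|hr]] := h (maxn m m0).
  by case: hm0; exists t => //; exact: leq_trans (leq_maxr _ _) ht.
by exists t => //; exact: leq_trans (leq_maxl _ _) ht.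
Qed.

(** * The run for fixed parameters [k] and [L] *)

Section Adaptive.
Context {R : realType}.
Variables (D0 M0 M : prf).
Hypothesis hM : forall c n, (exists z, eval M [:: c; z] n) <-> (exists t, answers D0 M0 c t n).
Variables (b : seq bool).
Let k := cfst (code b).
Let L := csnd (code b).
Let tr := trace D0 M0 k L.

(* What the hypothesis on finite sets provides once [L] is large enough with
   respect to [k]. *)
Hypothesis short_programs : forall S, finite_set S ->
  ((2 ^- (k + size (tag b)))%:E <= Prob_enum R M S)%E ->
  exists2 p, (size p <= L)%N & enumerates D0 p = S.

(** If the run stayed at [e] forever, [M] would enumerate exactly [goal e] on every sequence made of
    the tag and a member of the group of [e]. This event has measure at least
    [2 ^- (k + size (tag b))], so [short_programs] yields a program that ends the wait. *)
Lemma trace_unblocks t e h : tr t = e :: h ->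
  exists2 t', (t <= t')%N & tr t' = e :: h /\ covered D0 L t' (goal M0 e).
Proof.
move=> ht; apply: contrapT => hnot.
have stuck t' : (t <= t')%N -> tr t' = e :: h.
  move=> /subnK <-; elim: (t' - t)%N => // n IH; rewrite addSn /tr traceS.
  rewrite -/(tr (n + t)%N) IH /=; case: ifP => // hc.
  by case: hnot; exists (n + t)%N => //; exact: leq_addl.
have [t0 [ht0 htr0 he0 hadm]] := trace_head ht.
pose S : set nat := [set j | j \in goal M0 e].
have hS : finite_set S by exact: finite_seq.
have hout w : prefix w (size (tag b)) = tag b -> group M0 h e (tail (size (tag b)) w) ->
    penumerates M w = S.
  move=> hw hg; rewrite (penumerates_tag hM hw) -/k -/L -/tr.
  have hge t' : (t <= t')%N -> output M0 (tr t') (tail (size (tag b)) w) = goal M0 e.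
    by move=> /stuck ->; rewrite /output /= -/(output M0 h _) -/(group M0 h e _) hg.
  apply/seteqP; split=> j /= => [[t' hj]|hj]; last by exists t; rewrite hge.
  rewrite /S /= -(hge (maxn t t')) ?leq_maxl //.
  exact: (output_trace (leq_maxr t t')) hj.
have [p hp hpS] : exists2 p, (size p <= L)%N & enumerates D0 p = S.
  apply: short_programs => //.
  pose P s := (take (size (tag b)) s == tag b) &&
    group M0 h e (bits (drop (size (tag b)) s)).
  apply: (@le_trans _ _ (den (size (tag b) + t0) P)%:E); last first.
    apply: cantor_measure_ge => w /andP[/eqP h1 h2]; apply: hout.
      by rewrite take_bits ?leq_addr in h1.
    rewrite (@eq_group _ _ _ t0 _ (bits (drop (size (tag b)) (prefix w (size (tag b) + t0))))) //.
      move=> a; rewrite inE => /orP[/eqP -> //|]; rewrite -htr0; exact: trace_lt.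
    move=> i hi; rewrite /bits nth_drop nth_mkseq ?ltn_add2l //.
  have hP := @cnt_cylinder _ (tag b) (fun s => group M0 h e (bits s)) (leq_addr t0 _).
  rewrite addKn in hP; rewrite lee_fin /den [cnt _ P]hP !exprD.
  have h2 n : 0 < 2 ^+ n :> R by rewrite exprn_gt0.
  rewrite ler_pdivlMr ?mulr_gt0 // mulrC.
  rewrite invfM mulrA -(mulrA (2 ^+ _)) mulrAC.
  rewrite divff ?expf_neq0 // mul1r ler_pdivrMr // mulrC -!natrX -natrM ler_nat.
  exact: hadm.
have hcov : exists t1, forall t', (t1 <= t')%N -> yset D0 t' p = goal M0 e.
  have hsound t' j : j \in yset D0 t' p -> j \in goal M0 e.
    rewrite mem_filter => /andP[/enum_approx_sound hj _].
    by have : enumerates D0 p j by []; rewrite hpS.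
  have [t1 h1] : exists t1, forall t', (t1 <= t')%N -> {subset goal M0 e <= yset D0 t' p}.
    have : forall j, j \in goal M0 e -> exists s, forall t', (s <= t')%N -> j \in yset D0 t' p.
      move=> j hj; have [z hz] : enumerates D0 p j by rewrite hpS.
      have [s hs] := enum_approx_complete hz; exists s => t' ht'.
      by rewrite mem_filter hs // mem_iota add0n /=; case/andP: (hs _ ht').
    elim: (goal M0 e) => [|j u IH] hu; first by exists 0%N.
    have [s1 hs1] := hu j (mem_head _ _).
    have [|s2 hs2] := IH; first by move=> i hi; apply: hu; rewrite inE hi orbT.
    exists (maxn s1 s2) => t'; rewrite geq_max => /andP[ha hb] i.
    by rewrite inE => /orP[/eqP ->|hi]; [exact: hs1|exact: hs2].
  (* Both lists are strictly increasing, so equal members make them equal as lists. *)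
  exists t1 => t' ht'; apply: (irr_sorted_eq ltn_trans ltnn).
  - by apply: sorted_filter; [exact: ltn_trans|exact: iota_ltn_sorted].
  - by apply: sorted_filter; [exact: ltn_trans|exact: iota_ltn_sorted].
  - by move=> j; apply/idP/idP; [exact: hsound|exact: h1].
have [t1 h1] := hcov; apply: hnot; exists (maxn t t1); first exact: leq_maxl.
split; first by apply: stuck; exact: leq_maxl.
apply/hasP; exists (size p); first by rewrite mem_iota add0n ltnS.
apply/hasP; exists p; first by rewrite mem_strs.
by rewrite h1 // leq_maxr.
Qed.

Definition moves w t := exists2 e, tr t.+1 = e :: tr t & group M0 (tr t) e w.

Lemma tr_cases t : tr t.+1 = tr t \/ exists e,
  [/\ tr t.+1 = e :: tr t, (e < t)%N, ready D0 M0 L t (tr t) & admissible M0 k t (tr t) e].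
Proof. by rewrite /tr; case: traceP => [|e h1 h2 h3]; [left|right; exists e]. Qed.

Lemma output_stays w t : ~ moves w t -> output M0 (tr t.+1) w = output M0 (tr t) w.
Proof.
move=> h; have [->//|[e [he _ _ _]]] := tr_cases t.
by rewrite he /=; case: ifP => // hg; case: h; exists e.
Qed.

Lemma output_settled w m t : (forall t, (m <= t)%N -> ~ moves w t) -> (m <= t)%N ->
  output M0 (tr t) w = output M0 (tr m) w.
Proof.
move=> h /subnK <-; elim: (t - m)%N => // n IH.
by rewrite addSn output_stays //; apply: h; exact: leq_addl.
Qed.

Lemma infinitely_ready m : exists2 t, (m <= t)%N & ready D0 M0 L t (tr t).
Proof.
case htr : (tr m) => [|e h]; first by exists m => //; rewrite htr.
by have [t ht [htr' hc]] := trace_unblocks htr; exists t => //; rewrite htr'.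
Qed.

Lemma xset_settled (S : set nat) w N : penumerates M0 w = S ->
  exists q, forall r, (q <= r)%N -> xset M0 r N w = [seq j <- iota 0 N | `[< S j >]].
Proof.
move=> hS.
have h n : exists q, forall r j, (q <= r)%N -> (j < n)%N -> (j < N)%N -> S j ->
    j \in xset M0 r N w.
  elim: n => [|n [q hq]]; first by exists 0%N.
  have [hn|hn] := pselect (S n); last first.
    exists q => r j hr; rewrite ltnS leq_eqVlt => /orP[/eqP -> //|hj]; exact: hq.
  have [s hs] : exists s, forall r N, (s <= r)%N -> (n < N)%N -> n \in xset M0 r N w.
    by apply: xset_complete; rewrite hS.
  exists (maxn q s) => r j; rewrite geq_max => /andP[h1 h2].
  rewrite ltnS leq_eqVlt => /orP[/eqP -> hN _|hj]; [exact: hs|exact: hq].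
have [q hq] := h N; exists q => r hr; apply: eq_in_filter => j hj.
have hjN : (j < N)%N by move: hj; rewrite mem_iota add0n.
apply/idP/asboolP => [h1|/(hq r j hr hjN hjN)].
  by rewrite -hS; have [|] := @mem_xset M0 r N w j; first by rewrite mem_filter h1.
by rewrite mem_filter => /andP[].
Qed.

Lemma infinite_unbounded (S : set nat) (r : seq nat) : infinite_set S ->
  exists2 s, S s & forall j, j \in r -> (j < s)%N.
Proof.
move=> hS; have [B hB] : exists B, forall j, j \in r -> (j < B)%N.
  elim: r => [|i r [B hB]]; first by exists 0%N.
  exists (maxn i.+1 B) => j; rewrite inE leq_max => /orP[/eqP ->|/hB ->]; first by rewrite leqnn.
  by rewrite orbT.
apply: contrapT => hno; apply: hS; apply: (sub_finite_set _ (finite_II B)) => s hs /=.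
rewrite ltnNge; apply/negP => hBs; apply: hno; exists s => // j /hB hj.
exact: leq_trans hj hBs.
Qed.

(* If [e] is admissible forever without being chosen, then from some time on all
   the moves chosen are smaller than [e], which is impossible as no move is chosen
   twice. *)
Lemma admissible_chosen m e :
  (forall t, (m <= t)%N -> admissible M0 k t (tr t) e) ->
  exists2 t, (m <= t)%N & tr t.+1 = e :: tr t.
Proof.
move=> hadm; apply: contrapT => hno.
have grow n : exists2 t, (m <= t)%N & (n <= count (fun a => a < e)%N (tr t))%N.
  elim: n => [|n [t ht hn]]; first by exists m.
  have [t' ht'] := infinitely_ready (maxn t e.+1).
  rewrite geq_max in ht'; case/andP: ht' => htt' het' hr.
  have hmt' := leq_trans ht htt'.
  have hmono : (count (fun a => a < e)%N (tr t) <= count (fun a => a < e)%N (tr t'))%N.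
    rewrite -(subnK htt'); elim: (t' - t)%N => // i IH; rewrite addSn; apply: leq_trans IH _.
    by have [->//|[a [-> _ _ _]]] := tr_cases (i + t)%N; exact: leq_addl.
  have htr : tr t'.+1 = extend M0 k t' (tr t') by rewrite /tr traceS -/(tr t') hr.
  have he : e \in [seq a <- iota 0 t' | admissible M0 k t' (tr t') a].
    by rewrite mem_filter hadm // mem_iota add0n.
  move: htr; rewrite /extend; case hs : [seq _ <- _ | _] he => [|a s] //.
  rewrite inE => /orP[/eqP <- htr|hes htr]; first by case: hno; exists t'.
  exists t'.+1; first exact: leqW.
  have hae : (a < e)%N.
    have : sorted ltn (a :: s).
      by rewrite -hs; apply: sorted_filter; [exact: ltn_trans|exact: iota_ltn_sorted].
    by rewrite /= (path_sortedE ltn_trans) => /andP[/allP /(_ _ hes)].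
  by rewrite htr /= hae add1n ltnS; exact: leq_trans hn hmono.
have [t _] := grow e.+1; rewrite -size_filter => h.
have := @uniq_leq_size _ (seq.filter (fun a => a < e)%N (tr t)) (iota 0 e).
rewrite filter_uniq ?uniq_trace // size_iota => /(_ isT) h2.
have {}h2 := leq_trans h (h2 _); rewrite ltnn in h2; apply: notF; apply: h2 => a.
by rewrite mem_filter mem_iota add0n => /andP[].
Qed.

(** By contraposition, the event is the increasing union of the sets [K m] of sequences at rest from
    time [m] on, and each [K m] that of the sets [Kq q] on which a fixed segment of [S] is seen from
    time [q] on. Both unions are handled by [outer_bigcup], at an arbitrarily small cost. *)
Lemma infinite_mover (S : set nat) : infinite_set S ->
  ((2 ^- k)%:E < Prob_enum R M0 S)%E ->
  exists2 w, penumerates M0 w = S & forall m, exists2 t, (m <= t)%N & moves w t.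
Proof.
move=> hS; apply: contraPP => hno.
have hK w : penumerates M0 w = S -> exists m, forall t, (m <= t)%N -> ~ moves w t.
  move=> hw; apply: contrapT => h; apply: hno; exists w => // m.
  by apply: contrapT => h2; apply: h; exists m => t ht hm; apply: h2; exists t.
pose K m := [set w | penumerates M0 w = S /\ forall t, (m <= t)%N -> ~ moves w t].
have hKm m d : 0 < d -> outer (K m) (2 ^- k + d : R).
  move=> hd.
  (* The element [s] of [S] exceeds everything output by time [m], so the segment of [S] up to [s]
     strictly contains the output of every member of [K m]. *)
  have [s hs hsm] := infinite_unbounded (flatten [seq goal M0 e | e <- tr m]) hS.
  pose u := [seq j <- iota 0 s.+1 | `[< S j >]].
  pose Kq q := [set w | K m w /\ forall r, (q <= r)%N -> xset M0 r s.+1 w = u].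
  apply: (@le_outer _ _ [set w | exists q, Kq q w]).
    by move=> w hw; have [q hq] := xset_settled s.+1 hw.1; exists q.
  apply: outer_bigcup => // [q w [h1 h2]|q].
    by split=> // r hr; apply: h2; exact: ltnW.
  apply: contrapT => hnot.
  (* A set without a neighbourhood of measure at most [2 ^- k] is nonempty; the first [q] bits of a
     member serve to name the segment [u] in a move. *)
  have [w0 hw0] : exists w0, Kq q w0.
    apply: contrapT => hnone; apply: hnot; apply: (@outer_le _ _ (den 0 pred0)).
      by rewrite /den /cnt count_pred0 mul0r invr_ge0 exprn_ge0.
    by apply: outer_clopen => w hw; case: hnone; exists w.
  pose e := cpair q (cpair s.+1 (code (prefix w0 q))).
  have htime : time e = q by rewrite /time cpairK1.
  have hlevel : level e = s.+1 by rewrite /level cpairK2 cpairK1.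
  have hgoal : goal M0 e = u.
    rewrite /goal htime hlevel /e !cpairK2 bits_codeK -(hw0.2 q) //.
    by apply: eq_xset => i hi; exact: bits_prefix.
  have hgroup t w : (m <= t)%N -> Kq q w -> group M0 (tr t) e w.
    move=> ht [[hw1 hw2] hw3]; rewrite /group /joins htime hlevel hgoal hw3 // eqxx /=.
    rewrite (output_settled hw2 ht).
    have hlt j : j \in output M0 (tr m) w -> (j < s)%N.
      case: (eqVneq (output M0 (tr m) w) [::]) => [->//|/output_xset[a ha [_ <-]] hj].
      by apply: hsm; apply/flattenP; exists (goal M0 a) => //; exact: map_f.
    apply/andP; split.
      apply/allP => j hj; rewrite inE /u mem_filter mem_iota add0n leq0n /=.
      rewrite ltnS (ltnW (hlt _ hj)) andbT.
      by apply/asboolP; rewrite -hw1; exact: mem_output hj.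
    apply/hasP; exists s.
      by rewrite /u mem_filter mem_iota add0n leq0n ltnSn !andbT; apply/asboolP.
    by apply/negP => /hlt; rewrite ltnn.
  (* The group of [e] always contains [Kq q], hence has measure above [2 ^- k], so [e] remains
     admissible. Once chosen, it moves [w0] after time [m], a contradiction. *)
  have [t ht htr] : exists2 t, (maxn m e.+1 <= t)%N & tr t.+1 = e :: tr t.
    apply: admissible_chosen => t; rewrite geq_max => /andP[hmt het].
    have ho : outer (Kq q) (den t (fun x => group M0 (tr t) e (bits x)) : R).
      apply: outer_clopen => w hw; rewrite (@eq_group _ _ _ t _ w) ?hgroup //.
        by move=> a; rewrite inE => /orP[/eqP -> //|]; exact: trace_lt.
      by move=> i; exact: bits_prefix.
    have : 2 ^- k < den t (fun x => group M0 (tr t) e (bits x)) :> R.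
      by rewrite ltNge; apply/negP => hle; apply: hnot; exact: outer_le hle ho.
    rewrite /den ltr_pdivlMr ?exprn_gt0 // mulrC ltr_pdivrMr ?exprn_gt0 // mulrC.
    by rewrite -!natrX -natrM ltr_nat => /ltnW.
  rewrite geq_max in ht; case/andP: ht => hmt _.
  by apply: (hw0.1.2 t hmt); exists e => //; exact: hgroup.
apply/negP; rewrite -leNgt; apply/lee_addgt0Pr => d hd; rewrite -EFinD.
(* One half of [d] is spent inside each [K m], the other on their union. *)
apply: cantor_measure_le; rewrite [d](splitr d) addrA.
apply: (@le_outer _ _ [set w | exists m, K m w]).
  by move=> w hw; have [m hm] := hK w hw; exists m.
have hd2 : 0 < d / 2 by rewrite divr_gt0.
apply: outer_bigcup => // [m w [h1 h2]|m]; last exact: hKm.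
by split=> // t ht; apply: h2; exact: ltnW.
Qed.

(** Every move strictly enlarges the output. An output obtained from [e] has at most [time e] and at
    most [level e] elements, so a large output was observed late and up to a high level, and it
    contains [j]. *)
Lemma mover_output (S : set nat) w : penumerates M0 w = S ->
  (forall m, exists2 t, (m <= t)%N & moves w t) ->
  forall j, S j -> exists t0, forall t, (t0 <= t)%N -> j \in output M0 (tr t) w.
Proof.
move=> hw hmov j hj.
have grow n : exists t, (n <= size (output M0 (tr t) w))%N.
  elim: n => [|n [t ht]]; first by exists 0%N.
  have [t' htt' [e he hg]] := hmov t; exists t'.+1.
  have -> : output M0 (tr t'.+1) w = goal M0 e.
    by rewrite he /= -/(output M0 (tr t') w) -/(group M0 (tr t') e w) hg.
  case/andP: hg => _ /andP[/allP h1 /hasP[x hx hxn]].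
  have := @uniq_leq_size _ (x :: output M0 (tr t') w) (goal M0 e).
  rewrite /= hxn uniq_output => /(_ isT) h2; apply: leq_ltn_trans ht _.
  apply: leq_ltn_trans (h2 _) => [|i]; last first.
    by rewrite inE => /orP[/eqP ->|/h1].
  apply: uniq_leq_size; [exact: uniq_output|exact: output_trace].
have [s hs] : exists s, forall r n, (s <= r)%N -> (j < n)%N -> j \in xset M0 r n w.
  by apply: xset_complete; rewrite hw.
have [t0 ht0] := grow (s + j).+1.
exists t0 => t ht; apply: (output_trace ht).
have hne : output M0 (tr t0) w != [::] by rewrite -size_eq0 -lt0n (leq_trans _ ht0).
have [e _ [he _]] := output_xset hne; rewrite he in ht0 *; apply: hs.
  have : (size (xset M0 (time e) (level e) w) <= size (iota 0 (time e)))%N.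
    apply: uniq_leq_size; first exact: uniq_xset.
    by move=> i /mem_xset[_ hi _]; rewrite mem_iota add0n.
  by rewrite size_iota; lia.
have : (size (xset M0 (time e) (level e) w) <= size (iota 0 (level e)))%N.
  apply: uniq_leq_size; first exact: uniq_xset.
  by move=> i /mem_xset[hi _ _]; rewrite mem_iota add0n.
by rewrite size_iota; lia.
Qed.

Lemma short_program_infinite (S : set nat) : infinite_set S ->
  ((2 ^- k)%:E < Prob_enum R M0 S)%E ->
  exists2 p, (size p <= L)%N & enumerates D0 p = S.
Proof.
move=> hS /(infinite_mover hS)[w hw hmov].
pose r := flatten [seq strs l | l <- iota 0 L.+1].
(* After each move of [w] the run waits until some program in the finite list [r] matches the new
   output. *)
have [|p [hp hinf]] := @infinite_pigeonhole _ r (fun t p => yset D0 t p == output M0 (tr t) w).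
  move=> m; have [t hmt [e he hg]] := hmov m.
  have [t' htt' [htr hc]] := trace_unblocks he.
  exists t'; first by apply: leq_trans hmt _; exact: ltnW.
  case/hasP: hc => l hl /hasP[p hp hpe]; apply/hasP; exists p.
    by apply/flattenP; exists (strs l) => //; exact: map_f.
  by rewrite htr /= -/(output M0 (tr t) w) -/(group M0 (tr t) e w) hg.
exists p.
  have {}hp : p \in r by elim: r hp => //= a s IH [->|/IH h]; rewrite inE ?eqxx // h orbT.
  case/flattenP: hp => _ /mapP[l + ->]; rewrite mem_iota add0n mem_strs => /andP[_ hl] /eqP ->.
  by rewrite -ltnS.
apply/seteqP; split=> j hj.
  (* Matching times occur arbitrarily late: what [p] enumerates shows up in a matching output, hence
     in [S], and conversely an element of [S] is in all late outputs, hence in an approximation of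
     [p]. *)
  have [z hz] := hj; have [s hs] := enum_approx_complete hz.
  have [t ht /eqP hpt] := hinf s.
  rewrite -hw; apply: (@mem_output M0 (tr t)); rewrite -hpt mem_filter hs // mem_iota add0n /=.
  by case/andP: (hs _ ht).
have [t0 ht0] := mover_output hw hmov hj.
have [t ht /eqP hpt] := hinf t0; have := ht0 t ht; rewrite -hpt mem_filter => /andP[+ _].
exact: enum_approx_sound.
Qed.

End Adaptive.

(** * Estimates *)

Section Logarithm.
Context {R : realType}.
Implicit Types x y : R.
Local Notation lg := (lgtwo R).

Lemma ln2_ge : 2^-1 <= ln 2 :> R.
Proof.
have := @le_ln1Dx R (- 2^-1); rewrite (_ : 1 + - 2^-1 = 2^-1); last by field.
rewrite lnV ?posrE // lerN2 => h; apply: h.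
by rewrite ltrN2 invf_lt1 // ltr1n.
Qed.

Lemma ln2_gt0 : 0 < ln 2 :> R.
Proof. by have := ln2_ge; lra. Qed.

Lemma lg_le x y : 0 < x -> x <= y -> lg x <= lg y.
Proof.
move=> hx hxy; rewrite /lgtwo ler_pM2r ?invr_gt0 ?ln2_gt0 // ler_ln ?posrE //.
exact: lt_le_trans hxy.
Qed.

Lemma lgM x y : 0 < x -> 0 < y -> lg (x * y) = lg x + lg y.
Proof. by move=> hx hy; rewrite /lgtwo lnM ?posrE // mulrDl. Qed.

Lemma lgXn n : lg (2 ^+ n) = n%:R.
Proof.
rewrite /lgtwo lnXn // -[ln 2 *+ n]mulr_natl mulfK //.
by apply: lt0r_neq0; exact: ln2_gt0.
Qed.

Lemma lg1 : lg 1 = 0.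
Proof. exact: (lgXn 0). Qed.

Lemma lg2 : lg 2 = 1.
Proof. exact: (lgXn 1). Qed.

Lemma lg_le2 x : 0 < x -> lg x <= 2 * x.
Proof.
move=> hx; rewrite /lgtwo ler_pdivrMr ?ln2_gt0 //.
have h0 : ln x <= x.
  have := @le_ln1Dx R (x - 1); rewrite (_ : 1 + (x - 1) = x); last by ring.
  by move=> h; apply: le_trans (h _) _; lra.
have h : x * 1 <= x * (2 * ln 2) by rewrite ler_pM2l //; have := ln2_ge; lra.
by move: h0 h; lra.
Qed.

(** A large [s] makes the slope [2 / s] as small as desired. *)
Lemma lg_scale x s : 0 < x -> 0 < s -> lg x <= 2 * (x / s) + lg s.
Proof.
move=> hx hs; rewrite -{1}(divfK (lt0r_neq0 hs) x) lgM ?divr_gt0 // lerD2r.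
by apply: lg_le2; rewrite divr_gt0.
Qed.

Lemma exists_above_lg (a e g : R) : 0 <= a -> 0 <= e -> 0 < g ->
  exists2 B, a <= B & e + g * lg (2 + a + 3 * B) <= B.
Proof.
(* In [lg_scale] the choice [s = 12 * g] gives slope [1 / 6] after multiplication by [g]; the term
   [3 * B] then uses up half of [B], and the other half dominates the rest. *)
move=> ha he hg; pose B := 2 * (e + (2 + a) / 6 + g * `|lg (12 * g)|) + a.
have hn : 0 <= g * `|lg (12 * g)| by rewrite mulr_ge0 // ltW.
have hB : a <= B by rewrite /B; lra.
exists B => //.
have h12 : 0 < 12 * g by rewrite mulr_gt0.
have h1 : lg (2 + a + 3 * B) <= 2 * ((2 + a + 3 * B) / (12 * g)) + lg (12 * g).
  by apply: lg_scale => //; lra.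
have h2 : g * lg (2 + a + 3 * B) <= g * (2 * ((2 + a + 3 * B) / (12 * g)) + lg (12 * g)).
  by rewrite ler_pM2l.
have h3 : g * (2 * ((2 + a + 3 * B) / (12 * g)) + lg (12 * g)) =
    (2 + a + 3 * B) / 6 + g * lg (12 * g) by field; exact: lt0r_neq0.
have h4 : g * lg (12 * g) <= g * `|lg (12 * g)| by rewrite ler_pM2l // ler_norm.
by move: h2; rewrite h3 {2}/B; move: h4 hB ha; rewrite /B; lra.
Qed.

Lemma lg_ge1 x : 2 <= x -> 1 <= lg x.
Proof. by move=> hx; rewrite -lg2; apply: lg_le. Qed.

(** There is a circularity: [L] must pay for the tag, whose length grows with [L] and so with [B].
    It grows only logarithmically, so a large enough [B] absorbs it. *)
Lemma tag_estimate (a c C : R) : 1 <= a -> 0 <= c -> 0 <= C ->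
  exists2 B, 0 <= B & forall (k L l : nat),
    a * k%:R + B * lg (k%:R + 2) + B <= L%:R <= a * k%:R + B * lg (k%:R + 2) + B + 1 ->
    (2 ^ l <= (k + L).+1 ^ 2)%N ->
    let h := (k + (l + l).+1)%:R + c in a * h + C * lg (h + 2) + C <= L%:R.
Proof.
move=> ha hc hC.
(* The three arguments are the final coefficient of [lg (k + 2)], the sum of the constant terms, and
   the coefficient of [lg D], where [k + L + 1 <= D * (k + 2)]. *)
have [||| B hB1 hB2] := @exists_above_lg (4 * a + C) (a * (1 + c) + C * (21 + 2 * c))
  (4 * a + 8 * C).
- lra.
- by rewrite addr_ge0 ?mulr_ge0 //; lra.
- lra.
exists B; first lra.
move=> k L l /andP[hL1 hL2] hl /=.
set y : R := k%:R + 2; have hy : 2 <= y by rewrite lerDr.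
set x := lg y; have hx : 1 <= x by exact: lg_ge1.
have hxy : x <= 2 * y by apply: lg_le2; lra.
pose D : R := 2 + (4 * a + C) + 3 * B.
have hk : k%:R = y - 2 :> R by rewrite addrK.
have hD : (k + L).+1%:R <= D * y :> R.
  rewrite -addn1 !natrD hk.
  have h1 : B * x <= B * (2 * y) by rewrite ler_wpM2l //; lra.
  have h2 : B * 2 <= B * y by rewrite ler_wpM2l //; lra.
  have h3 : 0 <= (3 * a + C) * y by rewrite mulr_ge0 //; lra.
  move: hL2; rewrite -/y -/x hk /D; nra.
have hD1 : 1 <= D by rewrite /D; lra.
have hlD0 : 0 <= lg D by rewrite -lg1; exact: lg_le.
have hlD : l%:R <= 2 * lg D + 2 * x.
  rewrite -(lgXn l); apply: (@le_trans _ _ (lg ((D * y) * (D * y)))); last first.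
    have [hD0 hy0] : 0 < D /\ 0 < y by lra.
    by rewrite (lgM (mulr_gt0 hD0 hy0) (mulr_gt0 hD0 hy0)) (lgM hD0 hy0) -/x; lra.
  apply: lg_le; first by rewrite exprn_gt0.
  apply: (@le_trans _ _ ((k + L).+1%:R * (k + L).+1%:R)).
    by rewrite -natrX -natrM ler_nat mulnn.
  by apply: ler_pM.
set n : R := (k + (l + l).+1)%:R + c.
have hn : n <= k%:R + 1 + c + 4 * lg D + 4 * x.
  by rewrite /n -addn1 !natrD; lra.
have hn0 : 0 <= n by rewrite addr_ge0.
pose F := 10 + c + 4 * lg D.
have hlgn : lg (n + 2) <= x + 2 * F.
  apply: (@le_trans _ _ (lg (y * F))).
    apply: lg_le; first lra.
    have h1 : (1 + c + 4 * lg D) * 1 <= (1 + c + 4 * lg D) * y by rewrite ler_wpM2l //; lra.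
    by rewrite /F; move: h1 hn; rewrite hk; lra.
  by rewrite lgM ?lerD2l ?lg_le2 // /F; lra.
have h1 : a * n <= a * (k%:R + 1 + c + 4 * lg D + 4 * x) by rewrite ler_wpM2l //; lra.
have h2 : C * lg (n + 2) <= C * (x + 2 * F) by rewrite ler_wpM2l.
have h3 : (4 * a + C) * x <= B * x by rewrite ler_wpM2r //; lra.
move: hB2; rewrite -/D => hB2; move: hL1; rewrite -/y -/x.
move: h2; rewrite /F; nra.
Qed.

End Logarithm.

(** * Complexities in terms of probabilities and programs *)

Section Entropy.
Context {R : realType}.
Implicit Types (M : prob_machine) (S : set nat).

Lemma Prob_enum_fin M S : Prob_enum R M S = (fine (Prob_enum R M S))%:E.
Proof. exact: cantor_measure_fin. Qed.

Lemma H_M_le M S n : ((2 ^- n)%:E <= Prob_enum R M S)%E -> (H_M R M S <= n%:R%:E)%E.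
Proof.
rewrite Prob_enum_fin lee_fin /H_M /= => h.
have h2 : 0 < (2 ^- n : R) by rewrite invr_gt0 exprn_gt0.
have h0 := lt_le_trans h2 h; rewrite h0 lee_fin lerNl.
have -> : - n%:R = lgtwo R (2 ^- n).
  by rewrite -(lgXn n) /lgtwo lnV ?posrE ?exprn_gt0 // mulNr.
exact: lg_le.
Qed.

Lemma H_M_fin M S : (H_M R M S < +oo)%E ->
  0 <= fine (H_M R M S) /\ H_M R M S = (fine (H_M R M S))%:E.
Proof.
rewrite /H_M /=; case: ifP => // h _; split=> //=.
rewrite oppr_ge0 /lgtwo pmulr_lle0 ?invr_gt0 ?ln2_gt0 // ln_le0 //.
by rewrite -lee_fin -Prob_enum_fin; exact: cantor_measure_le1.
Qed.

Lemma Prob_enum_gt M S n : (H_M R M S < n%:R%:E)%E -> ((2 ^- n)%:E < Prob_enum R M S)%E.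
Proof.
rewrite Prob_enum_fin lte_fin /H_M /=; case: ifP => // h.
rewrite lte_fin; apply: contraTT; rewrite -!leNgt => hle.
rewrite lerNr -(lgXn n) -[- lgtwo R _]mulNr -lnV ?posrE ?exprn_gt0 //.
exact: lg_le.
Qed.

Lemma I_D_le (D : det_machine) S (n : nat) : (I_D R D S <= n%:R%:E)%E <->
  exists2 p, (size p <= n)%N & enumerates D p = S.
Proof.
split=> [h|[p hp hS]]; last first.
  apply: ereal_inf_le; exists (size p)%:R%:E; first by exists p.
  by rewrite lee_fin ler_nat.
(* A program of length below [n.+1] has length at most [n], which spares showing that the infimum is
   attained. *)
have : (I_D R D S < n.+1%:R%:E)%E by apply: le_lt_trans h _; rewrite lte_fin ltr_nat.
move=> /ereal_inf_lt[_ [p hp <-]]; rewrite lte_fin ltr_nat ltnS => hs.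
by exists p.
Qed.

End Entropy.

(** * Choice of the parameters and conclusion *)

Lemma code_surj (c : nat) : (0 < c)%N -> exists b, code b = c.
Proof.
move=> hc; pose l := trunc_log 2 c.
have : c \in index_iota (2 ^ l) (2 ^ l.+1) by rewrite mem_index_iota; exact: trunc_log_bounds.
by rewrite -(perm_mem (perm_code_strs _)) => /mapP[b _ ->]; exists b.
Qed.

Unset Implicit Arguments.

Theorem theorem3 (R : realType) (D0 : det_machine) (M0 : prob_machine)
  (hD0 : universal_det R D0) (hM0 : optimal_prob R M0)
  (alpha C : R) (halpha : 1 <= alpha)
  (hyp : forall S : set nat, finite_set S -> (H_M R M0 S < +oo)%E ->
     (I_D R D0 S <= (alpha * fine (H_M R M0 S)
                    + C * lgtwo R (fine (H_M R M0 S) + 2) + C)%:E)%E) :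
  exists C' : R, forall S : set nat, (H_M R M0 S < +oo)%E ->
     (I_D R D0 S <= (alpha * fine (H_M R M0 S)
                    + C' * lgtwo R (fine (H_M R M0 S) + 2) + C')%:E)%E.
Proof.
have [M hM] := enumerator_of (c_answers D0 M0).
(* The given constants may be negative; the estimates use nonnegative ones. *)
have [c0 hc0] := hM0 M; pose c := Num.max c0 0; pose Cp := Num.max C 0.
have hc : 0 <= c by rewrite le_max lexx orbT.
have hCp : 0 <= Cp by rewrite le_max lexx orbT.
have hC : C <= Cp by rewrite le_max lexx.
have [B hB0 hB] := tag_estimate halpha hc hCp.
(* With nonnegative coefficients the bound is monotone, so any upper bound [h] of the complexity may
   replace it. *)
have finite_bound S h : finite_set S -> (H_M R M0 S <= h%:E)%E -> 
    (I_D R D0 S <= (alpha * h + Cp * lgtwo R (h + 2) + Cp)%:E)%E.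
  move=> hS hh; have hlt : (H_M R M0 S < +oo)%E by apply: le_lt_trans hh (ltry _).
  have [h0 he] := H_M_fin hlt; rewrite he lee_fin in hh.
  apply: le_trans (hyp _ hS hlt) _; rewrite lee_fin; set f := fine _ in h0 hh *.
  have h1 : 1 <= lgtwo R (f + 2) by apply: lg_ge1; lra.
  have h2 : lgtwo R (f + 2) <= lgtwo R (h + 2) by apply: lg_le; lra.
  apply: (lerD _ hC); apply: lerD; first by rewrite ler_wpM2l //; lra.
  apply: (@le_trans _ _ (Cp * lgtwo R (f + 2))); first by rewrite ler_wpM2r //; lra.
  by rewrite ler_wpM2l.
(* Finite sets need [Cp]. For infinite ones, [k <= h + 1] costs [alpha],
   [lg (k + 2) <= 1 + lg (h + 2)] costs one [B], the constant of [y] the other, and rounding [y] up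
   to [L] costs 1. *)
exists (alpha + 2 * B + 1 + Cp) => S hlt.
have [h0 he] := H_M_fin hlt; set h := fine _ in h0 he *.
have hlg : 1 <= lgtwo R (h + 2) by apply: lg_ge1; lra.
have [hS|hS] := pselect (finite_set S).
  apply: le_trans (finite_bound S h hS _) _; first by rewrite he.
  rewrite lee_fin; have : Cp * lgtwo R (h + 2) <= (alpha + 2 * B + 1 + Cp) * lgtwo R (h + 2).
    by rewrite ler_wpM2r //; lra.
  by lra.
(* An integer strictly above [h], so that [S] has probability strictly more than [2 ^- k]. *)
pose k := (Num.trunc h).+1.
have /andP[hk1 hk2] := truncn_itv h0.
pose y := alpha * k%:R + B * lgtwo R (k%:R + 2) + B.
have hk : 1 <= k%:R :> R by rewrite ler1n.
have hlk : 1 <= lgtwo R (k%:R + 2) by apply: lg_ge1; lra.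
have hy : 0 <= y by rewrite /y !addr_ge0 // mulr_ge0 //; lra.
pose L := (Num.trunc y).+1.
have /andP[hL1 hL2] := truncn_itv hy.
have hL : y <= L%:R <= y + 1.
  by rewrite (ltW hL2) /= /L -addn1 natrD; lra.
have [b hb] : exists b, code b = cpair k L by apply: code_surj; rewrite /cpair addn_gt0 orbT.
have hcode : (2 ^ size b <= (k + L).+1 ^ 2)%N.
  by have /andP[h1 _] := code_bounds b; apply: leq_trans h1 _; rewrite hb; exact: cpair_leq.
have hcfst : cfst (code b) = k by rewrite hb cpairK1.
have hcsnd : csnd (code b) = L by rewrite hb cpairK2.
have [|||p hp hpS] := @short_program_infinite R D0 M0 M hM b _ S.
(* Passing from [M] to the optimal [M0] adds [c] to the complexity of [T]; the bound for finite sets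
   at this value is at most [L] by the choice of [B]. *)
- move=> T hT; rewrite hcfst hcsnd => hprob; apply/(@I_D_le R).
  have hH : (H_M R M0 T <= ((k + size (tag b))%:R + c)%:E)%E.
    apply: le_trans (hc0 T) _; rewrite EFinD; apply: leeD; first exact: H_M_le.
    by rewrite lee_fin le_max lexx.
  apply: le_trans (finite_bound T _ hT hH) _; rewrite lee_fin size_tag.
  exact: hB hL hcode.
- exact: hS.
- by rewrite hcfst; apply: Prob_enum_gt; rewrite he lte_fin.
rewrite hcsnd in hp.
have : (I_D R D0 S <= L%:R%:E)%E by apply/I_D_le; exists p.
move=> /le_trans; apply; rewrite lee_fin.
have hkh : k%:R <= h + 1 by rewrite /k -addn1 natrD; lra.
have hl3 : lgtwo R (k%:R + 2) <= 1 + lgtwo R (h + 2).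
  have hh : 0 < h + 2 by lra.
  have -> : 1 + lgtwo R (h + 2) = lgtwo R (2 * (h + 2)) by rewrite lgM // lg2.
  by apply: lg_le; lra.
have h1 : alpha * k%:R <= alpha * (h + 1) by rewrite ler_wpM2l //; lra.
have h2 : B * lgtwo R (k%:R + 2) <= B * (1 + lgtwo R (h + 2)) by rewrite ler_wpM2l.
have h3 : 0 <= (alpha + B + 1 + Cp) * lgtwo R (h + 2) by rewrite mulr_ge0 //; lra.
case/andP: hL => _ hL; move: hL; rewrite /y; lra.
Qed.
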